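(* Let $p$ be a prime, $n\ge1$, $f,g\in\Phi'(\mathbb{Q}_p^n)$, let $\rho$ be an automodel function on $\mathbb{Q}_p^*$, and let $\beta\in\mathbb{C}$. Then $$f(x)\stackrel{\Phi'}{\sim}g(x),\quad |x|_p\to\infty\quad\big(\rho(t)\big)$$ if and only if $$D^{\beta}_xf(x)\stackrel{\Phi'}{\sim}D^{\beta}_xg(x),\quad|x|_p\to\infty\quad\big(|t|_p^{-\beta}\rho(t)\big),$$ where $D^\beta_x$ is the Taibleson fractional operator.
   Context: $\mathbb{Q}_p$ has norm $|p|_p=p^{-1}$; $\mathbb{Q}_p^*=\mathbb{Q}_p\setminus\{0\}$; $|x|_p=\max_{1\le j\le n}|x_j|_p$ for $x\in\mathbb{Q}_p^n$; $d^nx$ is the Haar measure giving $B_0^n=\{x:|x|_p\le1\}$ measure $1$. $\mathcal{D}(\mathbb{Q}_p^n)$ is the space of locally constant compactly supported functions $\mathbb{Q}_p^n\to\mathbb{C}$; $\mathcal{D}'(\mathbb{Q}_p^n)$ is the space of all linear functionals on it. Fourier transform: $F[\varphi](\xi)=\int_{\mathbb{Q}_p^n}\chi_p(\xi\cdot x)\varphi(x)\,d^nx$, with $\chi_p(\xi\cdot x)=e^{2\pi i\sum_j\{\xi_jx_j\}_p}$, $\{\cdot\}_p$ the $p$-adic fractional part. $\Psi(\mathbb{Q}_p^n)=\{\psi\in\mathcal{D}(\mathbb{Q}_p^n):\psi(0)=0\}$; $\Phi(\mathbb{Q}_p^n)=\{F[\psi]:\psi\in\Psi(\mathbb{Q}_p^n)\}$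 (Lizorkin test functions of the second kind), and $\Phi'(\mathbb{Q}_p^n)$ is its dual (all linear functionals), with weak convergence. Multidimensional Riesz kernel $\kappa_a$, $a\in\mathbb{C}$. Put $\mu_j=\frac{2\pi i}{\ln p}j$, $j\in\mathbb{Z}$, $\Gamma_p^{(n)}(a)=\frac{1-p^{a-n}}{1-p^{-a}}$. For $a\neq\mu_j,n+\mu_j$: $\kappa_a(x)=|x|_p^{a-n}/\Gamma_p^{(n)}(a)$, where $$\langle|x|_p^{a-n},\varphi\rangle=\int_{B_0^n}|x|_p^{a-n}(\varphi(x)-\varphi(0))\,d^nx+\int_{\mathbb{Q}_p^n\setminus B_0^n}|x|_p^{a-n}\varphi(x)\,d^nx+\varphi(0)\frac{1-p^{-n}}{1-p^{-a}}.$$ For $a=\mu_j$: $\kappa_a=\delta$. For $a=n+\mu_j$: $\kappa_a(x)=-\frac{1-p^{-n}}{\log p}\log|x|_p$. The Taibleson operator: $(D^{\alpha}_x\phi)(x)=\langle\kappa_{-\alpha}(\xi),\phi(x-\xi)\rangle$ for $\phi\in\Phi$ (it maps $\Phi$ to itself), and $\langle D^{\alpha}_xf,\phi\rangle=\langle f,D^{\alpha}_x\phi\rangle$ for $f\in\Phi'$, $\phi\in\Phi$. An automodel function is a continuous $\rho:\mathbb{Q}_p^*\to\mathbb{C}$ such that for every $z\in\mathbb{Q}_p^*$ the limit $\lim_{|t|_p\to\infty}\rho(tz)/\rho(t)=C(z)$ exists, with $C$ a multiplicative character of $\mathbb{Q}_p$, $C(z)=\pi_\alpha(z)=|z|_p^{\alpha-1}\pi_1(z)$,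 where $\alpha\in\mathbb{C}$ and $\pi_1$ is a character with $|\pi_1|=1$, $\pi_1(p)=1$ (then $\rho$ has degree $\pi_\alpha$; in particular $\rho(t)\neq0$ for large $|t|_p$). For $t\in\mathbb{Q}_p^*$ and $f\in\Phi'$, $f(tx)$ is defined by $\langle f(tx),\phi(x)\rangle=|t|_p^{-n}\langle f(x),\phi(x/t)\rangle$. The notation $f(x)\stackrel{\Phi'}{\sim}g(x)$, $|x|_p\to\infty$ $(\rho(t))$ means: $g\not\equiv0$ in $\Phi'$ and $\frac{f(tx)}{\rho(t)}\to g(x)$ in $\Phi'(\mathbb{Q}_p^n)$ as $|t|_p\to\infty$, i.e. $\langle f(tx),\phi\rangle/\rho(t)\to\langle g,\phi\rangle$ for all $\phi\in\Phi(\mathbb{Q}_p^n)$. *)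

(* Defs.v *)
From HB Require Import structures.
From mathcomp Require Import all_boot all_order all_algebra ring_quotient.
From mathcomp Require Import complex ring lra.
From mathcomp Require Import all_classical all_reals all_analysis.
Set Implicit Arguments.
Unset Strict Implicit.
Unset Printing Implicit Defensive.
Import Order.TTheory GRing.Theory Num.Theory.
Import numFieldNormedType.Exports.
Local Open Scope classical_set_scope.
Local Open Scope ring_scope.

Section PadicNormRat.
Variable p : nat.
Implicit Types x y : rat.

Lemma logn_nprime q k : ~~ prime q -> logn q k = 0%N.
Proof. by rewrite lognE => /negPf ->. Qed.

(* Meaningful for p prime; otherwise padic_norm is the trivial norm. *)
Definition padic_val x : int := (logn p `|numq x|)%:Z - (logn p `|denq x|)%:Z.

Definition padic_norm x : rat :=
  if x == 0 then 0 else (p%:Q) ^ (- padic_val x).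

Lemma padic_val_frac (m d : int) : m != 0 -> d != 0 ->
  padic_val (m%:~R / d%:~R) = (logn p `|m|)%:Z - (logn p `|d|)%:Z.
Proof.
move=> m0 d0; set x : rat := _ / _.
have dQ : d%:~R != 0 :> rat by rewrite intr_eq0.
have x0 : x != 0 by rewrite mulf_neq0 ?invr_eq0 ?intr_eq0.
have nx0 : numq x != 0 by rewrite numq_eq0.
have e : m * denq x = numq x * d.
  apply/eqP; rewrite -(eqr_int rat) !intrM; apply/eqP.
  apply: (mulIf (invr_neq0 dQ)); rewrite mulfK// mulrAC -/x.
  by rewrite -{1}(divq_num_den x) divfK ?intr_eq0 ?denq_neq0.
have := congr1 (fun z : int => logn p `|z|%N) e; rewrite !abszM.
rewrite !lognM ?absz_gt0 ?denq_neq0 // => /(congr1 Posz).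
rewrite !PoszD /padic_val => e'.
apply/eqP; rewrite subr_eq addrAC eq_sym subr_eq; apply/eqP; exact: e'.
Qed.

Lemma padic_normE (m d : int) : m != 0 -> d != 0 ->
  padic_norm (m%:~R / d%:~R) =
  (p%:Q) ^ ((logn p `|d|)%:Z - (logn p `|m|)%:Z).
Proof.
move=> m0 d0; rewrite /padic_norm mulf_eq0 invr_eq0 !intr_eq0 (negPf m0).
by rewrite (negPf d0)/= padic_val_frac // opprB.
Qed.

Lemma padic_norm0 : padic_norm 0 = 0. Proof. by rewrite /padic_norm eqxx. Qed.

Lemma padic_norm1 : padic_norm 1 = 1.
Proof. by rewrite /padic_norm /padic_val /= logn1 subrr oppr0 expr0z. Qed.

Lemma padic_norm_neq0 x : x != 0 -> padic_norm x != 0.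
Proof.
rewrite /padic_norm => /negPf ->; case: (posnP p) => [p0|p0].
  have lz k : logn p k = 0%N by rewrite lognE p0.
  by rewrite /padic_val !lz subrr oppr0 expr0z oner_eq0.
by rewrite expfz_neq0 // pnatr_eq0 -lt0n.
Qed.

Lemma padic_norm_ge0 x : 0 <= padic_norm x.
Proof. by rewrite /padic_norm; case: ifP => // _; rewrite exprz_ge0 // ler0n. Qed.

Lemma padic_norm_eq0 x : (padic_norm x == 0) = (x == 0).
Proof.
by have [->|/padic_norm_neq0/negPf] := eqVneq x 0; rewrite ?padic_norm0 ?eqxx.
Qed.

Lemma padic_normN x : padic_norm (- x) = padic_norm x.
Proof. by rewrite /padic_norm oppr_eq0 /padic_val numqN denqN abszN. Qed.

Lemma padic_normM x y : padic_norm (x * y) = padic_norm x * padic_norm y.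
Proof.
have [->|x0] := eqVneq x 0; first by rewrite mul0r padic_norm0 mul0r.
have [->|y0] := eqVneq y 0; first by rewrite mulr0 padic_norm0 mulr0.
rewrite -(divq_num_den x) -(divq_num_den y) mulrACA -invfM -!intrM.
have [nx ny] : numq x != 0 /\ numq y != 0 by rewrite !numq_eq0.
rewrite !padic_normE ?mulf_neq0 ?denq_neq0 //.
rewrite !abszM !lognM ?absz_gt0 ?denq_neq0 // !PoszD.
case: (posnP p) => [p0|p0].
  have lz k : logn p k = 0%N by rewrite lognE p0.
  by rewrite !lz !(addr0, subr0) !expr0z mulr1.
rewrite -expfzDr ?pnatr_eq0 -?lt0n //; congr (_ ^ _).
by rewrite opprD addrACA.
Qed.

Lemma padic_normV x : padic_norm x^-1 = (padic_norm x)^-1.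
Proof.
have [->|x0] := eqVneq x 0; first by rewrite invr0 padic_norm0.
apply: (mulfI (padic_norm_neq0 x0)); rewrite -padic_normM !divff ?padic_norm1 //.
exact: padic_norm_neq0.
Qed.

Lemma padic_norm_ultra_int (a b : int) :
  a != 0 -> b != 0 -> a + b != 0 ->
  (minn (logn p `|a|) (logn p `|b|) <= logn p `|(a + b)%R|)%N.
Proof.
move=> a0 b0 ab0; case: (boolP (prime p)) => [pp|np]; last first.
  by rewrite !logn_nprime.
rewrite -pfactor_dvdn ?absz_gt0 //.
suff : ((p ^ minn (logn p `|a|) (logn p `|b|))%N%:Z %| a + b)%Z.
  by rewrite dvdzE.
by apply: rpredD; rewrite dvdzE /= pfactor_dvdn ?absz_gt0 // ?geq_minl ?geq_minr.
Qed.

Lemma padic_norm_ultra x y :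
  padic_norm (x + y) <= Num.max (padic_norm x) (padic_norm y).
Proof.
have [->|x0] := eqVneq x 0; first by rewrite add0r le_max lexx orbT.
have [->|y0] := eqVneq y 0; first by rewrite addr0 le_max lexx.
have [->|xy0] := eqVneq (x + y) 0.
  by rewrite padic_norm0 le_max !padic_norm_ge0.
have [nx ny] : numq x != 0 /\ numq y != 0 by rewrite !numq_eq0.
have [dx dy] : denq x != 0 /\ denq y != 0 by rewrite !denq_neq0.
set D := denq x * denq y.
have D0 : D != 0 by rewrite mulf_neq0.
set a := numq x * denq y; set b := numq y * denq x.
have ex : x = a%:~R / D%:~R.
  by rewrite /a /D !intrM invfM mulrACA divff ?intr_eq0// mulr1 divq_num_den.
have ey : y = b%:~R / D%:~R.
  rewrite /b /D !intrM invfM [_^-1 * _]mulrC mulrACA divff ?intr_eq0//.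
  by rewrite mulr1 divq_num_den.
have exy : x + y = (a + b)%:~R / D%:~R by rewrite intrD mulrDl -ex -ey.
have a0 : a != 0 by rewrite mulf_neq0.
have b0 : b != 0 by rewrite mulf_neq0.
have ab0 : a + b != 0.
  by apply: contraNneq xy0 => h; rewrite exy h mul0r.
rewrite exy [in X in Num.max X _]ex [in X in Num.max _ X]ey !padic_normE //.
have := padic_norm_ultra_int a0 b0 ab0.
case: (boolP (prime p)) => [pp|np]; last by rewrite !logn_nprime // maxxx.
have p1 : 1 < p%:Q by rewrite ltr1n prime_gt1.
rewrite geq_min le_max => /orP[h|h]; apply/orP; [left|right];
  by rewrite ler_eXz2l // lerD2l lerN2 lez_nat.
Qed.

Lemma padic_normD x y : padic_norm (x + y) <= padic_norm x + padic_norm y.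
Proof.
apply: (le_trans (padic_norm_ultra _ _)).
by rewrite ge_max lerDl lerDr !padic_norm_ge0.
Qed.

Lemma padic_norm_dist x y : `|padic_norm x - padic_norm y| <= padic_norm (x - y).
Proof.
rewrite ler_norml; apply/andP; split.
  rewrite lerNl opprB lerBlDr -(padic_normN (x - y)) opprB.
  by rewrite -{1}(subrK x y) padic_normD.
by rewrite lerBlDr -{1}(subrK y x) padic_normD.
Qed.

End PadicNormRat.

Section CauchySequences.
Variable p : nat.
Implicit Types u v : nat -> rat.

Definition padic_cauchy u := forall e : rat, 0 < e ->
  exists N, forall m n, (N <= m)%N -> (N <= n)%N -> padic_norm p (u m - u n) < e.

Definition padic_null u := forall e : rat, 0 < e ->
  exists N, forall n, (N <= n)%N -> padic_norm p (u n) < e.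

Definition padic_cauchyb : pred (nat -> rat) := fun u => `[< padic_cauchy u >].

Lemma padic_cauchy_bounded u : padic_cauchy u ->
  exists2 M, 0 < M & forall n, padic_norm p (u n) <= M.
Proof.
move=> /(_ _ ltr01)[N hN].
exists (1 + \sum_(i < N.+1) padic_norm p (u i)) => [|n].
  by rewrite ltr_pwDl // sumr_ge0 // => i _; exact: padic_norm_ge0.
have le (k : 'I_N.+1) : padic_norm p (u k) <= \sum_(i < N.+1) padic_norm p (u i).
  rewrite (bigD1 k) //= lerDl sumr_ge0 // => i _; exact: padic_norm_ge0.
case: (leqP n N) => hn.
  by rewrite (le_trans (le (Ordinal (hn : n < N.+1)%N))) // lerDr.
rewrite -(subrK (u N) (u n)) (le_trans (padic_normD _ _ _)) // lerD //.
  by apply/ltW/hN => //; exact: ltnW.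
exact: (le ord_max).
Qed.

Lemma padic_cauchy_subring : subring_closed padic_cauchyb.
Proof.
split=> [|u v|u v].
- apply/asboolP => e e0; exists 0%N => m n _ _.
  by rewrite subrr padic_norm0.
- move=> /asboolP cu /asboolP cv; apply/asboolP => e e0.
  have e2 : 0 < e / 2 by rewrite divr_gt0.
  have [N1 h1] := cu _ e2; have [N2 h2] := cv _ e2.
  exists (maxn N1 N2) => m n; rewrite !geq_max => /andP[m1 m2] /andP[n1 n2].
  have -> : (u - v) m - (u - v) n = (u m - u n) - (v m - v n).
    by rewrite !fctE; ring.
  rewrite (le_lt_trans (padic_normD _ _ _)) // padic_normN [ltRHS]splitr.
  by rewrite ltrD ?h1 ?h2.
- move=> /asboolP cu /asboolP cv; apply/asboolP => e e0.
  have [Mu Mu0 hu] := padic_cauchy_bounded cu.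
  have [Mv Mv0 hv] := padic_cauchy_bounded cv.
  have eu : 0 < e / 2 / Mv by rewrite !divr_gt0.
  have ev : 0 < e / 2 / Mu by rewrite !divr_gt0.
  have [N1 h1] := cu _ eu; have [N2 h2] := cv _ ev.
  exists (maxn N1 N2) => m n; rewrite !geq_max => /andP[m1 m2] /andP[n1 n2].
  have -> : (u * v) m - (u * v) n = (u m - u n) * v m + u n * (v m - v n).
    by rewrite !fctE; ring.
  rewrite (le_lt_trans (padic_normD _ _ _)) // [ltRHS]splitr !padic_normM.
  apply: ltrD.
    rewrite (le_lt_trans (ler_wpM2l (padic_norm_ge0 _ _) (hv m))) //.
    by rewrite -ltr_pdivlMr // h1.
  rewrite (le_lt_trans (ler_wpM2r (padic_norm_ge0 _ _) (hu n))) //.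
  by rewrite mulrC -ltr_pdivlMr // h2.
Qed.

HB.instance Definition _ :=
  GRing.isSubringClosed.Build _ padic_cauchyb padic_cauchy_subring.

Record cauchy_seq := CauchySeq {
  cseq :> nat -> rat;
  cseqP : padic_cauchyb cseq }.

HB.instance Definition _ := [isSub for cseq].
HB.instance Definition _ := [Choice of cauchy_seq by <:].
HB.instance Definition _ := [SubChoice_isSubComNzRing of cauchy_seq by <:].

Lemma cauchy_seqP (u : cauchy_seq) : padic_cauchy u.
Proof. exact/asboolP/cseqP. Qed.

Definition null_seqb : pred cauchy_seq :=
  fun u : cauchy_seq => `[< padic_null u >].

Lemma null_seq_idealr : idealr_closed null_seqb.
Proof.
split=> [||a u v].
- apply/asboolP => e e0; exists 0%N => n _.
  by rewrite [cseq _ _]/= padic_norm0.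
- apply/asboolP => /(_ _ ltr01)[N /(_ N (leqnn N))].
  by rewrite [cseq _ _]/= padic_norm1 ltxx.
- move=> /asboolP nu /asboolP nv; apply/asboolP => e e0.
  have [M M0 ha] := padic_cauchy_bounded (cauchy_seqP a).
  have e1 : 0 < e / 2 / M by rewrite !divr_gt0.
  have e2 : 0 < e / 2 by rewrite divr_gt0.
  have [N1 h1] := nu _ e1; have [N2 h2] := nv _ e2.
  exists (maxn N1 N2) => n; rewrite geq_max => /andP[n1 n2].
  rewrite [cseq _ _]/= (le_lt_trans (padic_normD _ _ _)) // [ltRHS]splitr ltrD ?h2 //.
  rewrite padic_normM (le_lt_trans (ler_wpM2r (padic_norm_ge0 _ _) (ha n))) //.
  by rewrite mulrC -ltr_pdivlMr // h1.
Qed.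

HB.instance Definition _ := isIdealr.Build _ null_seqb null_seq_idealr.

Lemma cauchy_away u : padic_cauchy u -> ~ padic_null u ->
  exists2 d : rat, 0 < d & exists N, forall n, (N <= n)%N -> d <= padic_norm p (u n).
Proof.
move=> cu /existsNP[e /not_implyP[e0 /forallNP nu]].
have e2 : 0 < e / 2 by rewrite divr_gt0.
have [N hN] := cu _ e2; exists (e / 2) => //; exists N => n Nn.
have := nu N => /existsNP[m /not_implyP[Nm /negP]]; rewrite -leNgt => hm.
have := hN m n Nm Nn; have := padic_norm_dist p (u m) (u n).
rewrite ler_norml => /andP[_ h1] h2; lra.
Qed.

Definition inv_seq u : nat -> rat := fun n => (u n)^-1.

Lemma inv_seq_cauchy u : padic_cauchy u -> ~ padic_null u ->
  padic_cauchyb (inv_seq u).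
Proof.
move=> cu nu; have [d d0 [N hN]] := cauchy_away cu nu; apply/asboolP => e e0.
have ed : 0 < e * d * d by rewrite !mulr_gt0.
have [N' hN'] := cu _ ed; exists (maxn N N') => m n.
rewrite !geq_max => /andP[m1 m2] /andP[n1 n2].
have um : u m != 0.
  by rewrite -(padic_norm_eq0 p) gt_eqF // (lt_le_trans d0) ?hN.
have un : u n != 0.
  by rewrite -(padic_norm_eq0 p) gt_eqF // (lt_le_trans d0) ?hN.
have -> : inv_seq u m - inv_seq u n = (u n - u m) / (u m * u n).
  by rewrite /inv_seq; field; rewrite um un.
rewrite padic_normM padic_normV padic_normM ltr_pdivrMr; last first.
  by rewrite mulr_gt0 // (lt_le_trans d0) ?hN.
rewrite (lt_le_trans (hN' n m n2 m2)) // -mulrA.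
apply: ler_wpM2l; first exact: ltW.
by apply: ler_pM; rewrite ?(ltW d0) // hN.
Qed.

Definition cauchy_inv (u : cauchy_seq) : cauchy_seq := insubd 0 (inv_seq u).

Lemma cauchy_invP (u : cauchy_seq) : ~ padic_null u ->
  cauchy_inv u * u - 1 \in null_seqb.
Proof.
move=> nu; have iu := inv_seq_cauchy (cauchy_seqP u) nu.
have [d d0 [N hN]] := cauchy_away (cauchy_seqP u) nu.
apply/asboolP => e e0; exists N => n Nn.
have -> : (cauchy_inv u * u - 1 : cauchy_seq) n = (cauchy_inv u : nat -> rat) n * u n - 1.
  by [].
rewrite /cauchy_inv insubdK // mulVf ?subrr ?padic_norm0 //.
by rewrite -(padic_norm_eq0 p) gt_eqF // (lt_le_trans d0) ?hN.
Qed.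

End CauchySequences.

Section PadicNumbers.
Local Open Scope quotient_scope.
Variable p : nat.

(* Cauchy sequences of rationals for the p-adic norm, modulo null ones. *)
Definition Qp := {ideal_quot (@null_seqb p : idealr _)}.

HB.instance Definition _ := EqQuotient.on Qp.
HB.instance Definition _ := GRing.ComNzRing.on Qp.

Lemma Qp_pi_eq0 (u : cauchy_seq p) : (\pi_Qp u == 0) = `[< padic_null p u >].
Proof. by rewrite piE Quotient.equivE subr0. Qed.

Definition Qp_inv (x : Qp) : Qp :=
  if x == 0 then 0 else \pi_Qp (cauchy_inv (repr x)).

Lemma Qp_mulVx (x : Qp) : x != 0 -> Qp_inv x * x = 1.
Proof.
move=> x0; rewrite /Qp_inv (negPf x0); move: x0.
rewrite -{1 3}[x]reprK Qp_pi_eq0 => /asboolPn nx.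
apply/eqP; rewrite piE Quotient.equivE; exact: cauchy_invP.
Qed.

Lemma Qp_inv0 : Qp_inv 0 = 0. Proof. by rewrite /Qp_inv eqxx. Qed.

HB.instance Definition _ := GRing.ComNzRing_isField.Build Qp Qp_mulVx Qp_inv0.

End PadicNumbers.

Section PadicNorm.
Local Open Scope quotient_scope.
Variable p : nat.
Implicit Types x y : Qp p.

(* The p-adic norm of a p-adic number is rational (0 or a power of p). *)
Definition Qp_norm x : rat :=
  lim ((fun n => padic_norm p (repr x n) : rat^o) @ \oo).

Lemma padic_norm_dom (a b : rat) :
  padic_norm p (a - b) < padic_norm p b -> padic_norm p a = padic_norm p b.
Proof.
move=> h; apply/eqP; rewrite eq_le; apply/andP; split.
  rewrite -{1}(subrK b a) (le_trans (padic_norm_ultra _ _ _)) //.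
  by rewrite ge_max lexx ltW.
have := padic_norm_ultra p a (b - a).
by rewrite addrC subrK -(padic_normN _ (b - a)) opprB le_max (leNgt _ (_ (a - b))) h orbF.
Qed.

Lemma padic_norm_cvg (u : nat -> rat) : padic_cauchy p u ->
  cvg ((fun n => padic_norm p (u n) : rat^o) @ \oo).
Proof.
move=> cu; have [nu|nu] := pselect (padic_null p u).
  apply/cvg_ex; exists 0; apply/cvgrPdist_lt => e e0.
  have [N hN] := nu _ e0; near=> n.
  rewrite sub0r normrN ger0_norm ?padic_norm_ge0 // hN //.
  by near: n; exact: nbhs_infty_ge.
have [d d0 [N hN]] := cauchy_away cu nu; have [N' hN'] := cu _ d0.
apply/cvg_ex; exists (padic_norm p (u (maxn N N'))).
apply: cvg_near_cst; near=> n; apply: padic_norm_dom.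
have nN : (maxn N N' <= n)%N by near: n; exact: nbhs_infty_ge.
rewrite (lt_le_trans (hN' _ _ _ _)) ?hN ?leq_maxl ?leq_maxr //.
exact: leq_trans (leq_maxr _ _) nN.
Unshelve. all: by end_near. Qed.

Lemma Qp_norm_cvg (u : cauchy_seq p) :
  (fun n => padic_norm p (u n) : rat^o) @ \oo --> (Qp_norm (\pi_(Qp p) u) : rat^o).
Proof.
rewrite /Qp_norm; set v := repr _.
have cv := padic_norm_cvg (cauchy_seqP v); move: cv.
set l := lim _ => cv.
have : null_seqb (u - v).
  by rewrite /null_seqb -Qp_pi_eq0 pi_addr pi_oppr /v reprK subrr.
move=> /asboolP nuv; apply/cvgrPdist_lt => e e0.
have e2 : 0 < e / 2 by rewrite divr_gt0.
have [N hN] := nuv _ e2; near=> n.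
have -> : l - padic_norm p (u n) =
  (l - padic_norm p (v n)) + (padic_norm p (v n) - padic_norm p (u n)) by ring.
rewrite (le_lt_trans (ler_normD _ _)) // [ltRHS]splitr ltrD //.
  by near: n; move/cvgrPdist_lt : cv; apply.
rewrite distrC (le_lt_trans (padic_norm_dist _ _ _)) //.
have -> : u n - v n = (u - v : cauchy_seq p) n by [].
by apply: hN; near: n; exact: nbhs_infty_ge.
Unshelve. all: by end_near. Qed.

Lemma Qp_norm0 : Qp_norm 0 = 0.
Proof.
have := @Qp_norm_cvg 0; rewrite pi_zeror.
have -> : (fun n => padic_norm p ((0 : cauchy_seq p) n) : rat^o) = cst 0.
  by apply/funext => n; exact: padic_norm0.
move=> h; exact: (cvg_unique (@norm_hausdorff _ rat^o) h (cvg_cst _)).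
Qed.

Lemma Qp_normN x : Qp_norm (- x) = Qp_norm x.
Proof.
rewrite -[x]reprK -pi_oppr; have := @Qp_norm_cvg (- repr x).
have -> : (fun n => padic_norm p ((- repr x : cauchy_seq p) n) : rat^o) =
    (fun n => padic_norm p (repr x n) : rat^o).
  by apply/funext => n; exact: padic_normN.
move=> h; exact: (cvg_unique (@norm_hausdorff _ rat^o) h (@Qp_norm_cvg _)).
Qed.

Lemma Qp_normD x y : Qp_norm (x + y) <= Qp_norm x + Qp_norm y.
Proof.
rewrite -[x]reprK -[y]reprK -pi_addr.
apply: ler_cvg_to (@Qp_norm_cvg _)
  (cvgD (@Qp_norm_cvg (repr x)) (@Qp_norm_cvg (repr y))) _.
by near=> n; exact: padic_normD.
Unshelve. all: by end_near. Qed.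

Definition Qp_ball x (e : rat) y := Qp_norm (x - y) < e.

Lemma Qp_ball_center x (e : rat) : 0 < e -> Qp_ball x e x.
Proof. by rewrite /Qp_ball subrr Qp_norm0. Qed.

Lemma Qp_ball_sym x y (e : rat) : Qp_ball x e y -> Qp_ball y e x.
Proof. by rewrite /Qp_ball -Qp_normN opprB. Qed.

Lemma Qp_ball_triangle x y z (e1 e2 : rat) :
  Qp_ball x e1 y -> Qp_ball y e2 z -> Qp_ball x (e1 + e2) z.
Proof.
rewrite /Qp_ball => h1 h2.
have -> : x - z = (x - y) + (y - z) by rewrite addrA subrK.
by rewrite (le_lt_trans (Qp_normD _ _)) // ltrD.
Qed.

Lemma Qp_nbhsE : nbhs_ball_ Qp_ball = nbhs_ (entourage_ Qp_ball).
Proof.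
rewrite /nbhs_ entourage_E predeq2E => x A; split.
  move=> [e e0 sbeA].
  exists [set xy | Qp_ball xy.1 e xy.2]; first by exists e.
  by move=> y /xsectionP/sbeA.
by move=> [E [e e0 sbeE] sEA]; exists e => // y xe_y; exact/sEA/xsectionP/sbeE.
Qed.

HB.instance Definition _ := isPointed.Build (Qp p) 0.
HB.instance Definition _ := hasNbhs.Build (Qp p) (nbhs_ball_ Qp_ball).
HB.instance Definition _ := @Nbhs_isPseudoMetric.Build rat (Qp p)
  (entourage_ Qp_ball) Qp_nbhsE Qp_ball
  Qp_ball_center Qp_ball_sym Qp_ball_triangle erefl.

End PadicNorm.


Section RationalsInQp.
Local Open Scope quotient_scope.
Variable p : nat.

Lemma padic_cauchy_cst (q : rat) : padic_cauchyb p (fun=> q).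
Proof.
by apply/asboolP => e e0; exists 0%N => m k _ _; rewrite subrr padic_norm0.
Qed.

Definition Qp_of_rat (q : rat) : Qp p := \pi_(Qp p) (CauchySeq (padic_cauchy_cst q)).

Fact Qp_of_rat_zmod : zmod_morphism Qp_of_rat.
Proof.
move=> q r; rewrite /Qp_of_rat -pi_oppr -pi_addr; congr (\pi_(Qp p) _).
exact: val_inj.
Qed.

Fact Qp_of_rat_monoid : monoid_morphism Qp_of_rat.
Proof.
split; first by rewrite /Qp_of_rat -pi_oner; congr (\pi_(Qp p) _); exact: val_inj.
move=> q r; rewrite /Qp_of_rat -pi_mulr; congr (\pi_(Qp p) _); exact: val_inj.
Qed.

HB.instance Definition _ :=
  GRing.isZmodMorphism.Build rat (Qp p) Qp_of_rat Qp_of_rat_zmod.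
HB.instance Definition _ :=
  GRing.isMonoidMorphism.Build rat (Qp p) Qp_of_rat Qp_of_rat_monoid.

Lemma Qp_norm_ratr (q : rat) : Qp_norm (ratr q : Qp p) = padic_norm p q.
Proof.
rewrite -(fmorph_eq_rat Qp_of_rat).
have h : cst (padic_norm p q : rat^o) @ \oo --> (Qp_norm (Qp_of_rat q) : rat^o).
  exact: (@Qp_norm_cvg p (CauchySeq (padic_cauchy_cst q))).
exact: (cvg_unique (@norm_hausdorff _ rat^o) h (cvg_cst _)).
Qed.

Lemma Qp_norm_p : prime p -> Qp_norm (p%:R : Qp p) = p%:R^-1.
Proof.
move=> pp; rewrite -(ratr_nat (Qp p)) Qp_norm_ratr.
have p0 : p%:Z != 0 by rewrite eqz_nat -lt0n prime_gt0.
rewrite -[p%:R in LHS]divr1 (@padic_normE p p%:Z 1) // logn1 sub0r.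
by rewrite absz_nat logn_prime // eqxx; exact: exprN1.
Qed.

End RationalsInQp.

Section ComplexTopology.
Variable R : rcfType.
HB.instance Definition _ := PseudoPointedMetric.copy R[i] R[i]^o.
HB.instance Definition _ := NormedModule.copy R[i] R[i]^o.
End ComplexTopology.

Local Open Scope complex_scope.

Section ComplexFunctions.
Variable R : realType.

Definition cexp (z : R[i]) : R[i] :=
  (expR (complex.Re z))%:C * (cos (complex.Im z) +i* sin (complex.Im z)).

(* [cpow r a] is the principal value of r^a for r > 0. *)
Definition cpow (r : R) (a : R[i]) : R[i] := cexp (a * (ln r)%:C).

Definition cintegral d (T : measurableType d) (mu : {measure set T -> \bar R})
    (D : set T) (f : T -> R[i]) : R[i] :=
  (\int[mu]_(x in D) complex.Re (f x))%R +i*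
  (\int[mu]_(x in D) complex.Im (f x))%R.

End ComplexFunctions.

Section PadicVectors.
Variables (p n : nat).

Definition Qpn_norm (x : 'rV[Qp p]_n) : rat :=
  \big[Num.max/0]_(j < n) Qp_norm (x 0 j).

Definition borel_Qpn := g_sigma_algebraType (@open 'rV[Qp p]_n).

Definition unit_ball : set 'rV[Qp p]_n := [set x | Qpn_norm x <= 1].

End PadicVectors.

Section RealPadicNorm.
Variables (R : realType) (p n : nat).

Definition Qp_abs (x : Qp p) : R := ratr (Qp_norm x).
Definition Qpn_abs (x : 'rV[Qp p]_n) : R := ratr (Qpn_norm x).

(* {x}_p is the unique r in Z[1/p] with 0 <= r < 1 and x - r in Z_p. *)
Definition Qp_frac (x : Qp p) : rat :=
  xget 0 [set r : rat | [/\ 0 <= r < 1,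
                            exists k : nat, r * p%:R ^+ k \is a Num.int
                          & Qp_norm (x - ratr r) <= 1]].

Definition Qp_char (xi x : 'rV[Qp p]_n) : R[i] :=
  cexp (0 +i* (2 * pi * \sum_(j < n) ratr (Qp_frac (xi 0 j * x 0 j)))).

End RealPadicNorm.

Definition Qp_infty (p : nat) : set_system (Qp p) :=
  filter_from setT (fun M : rat => [set t | M < Qp_norm t]).
Arguments Qp_infty : clear implicits.

#[global] Instance Qp_infty_filter (p : nat) : Filter (Qp_infty p).
Proof.
apply: filter_from_filter => [|M N _ _]; first by exists 0.
by exists (Num.max M N) => // t /=; rewrite gt_max => /andP[].
Qed.

Section Automodel.
Variables (R : realType) (p : nat).

(* Functions on Q_p^* are represented by total functions on Q_p, whose value
   at 0 is never used. *)
Definition unitary_char (pi1 : Qp p -> R[i]) : Prop :=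
  [/\ forall z, z != 0 -> {for z, continuous pi1},
      forall z w, z != 0 -> w != 0 -> pi1 (z * w) = pi1 z * pi1 w,
      forall z, z != 0 -> `|pi1 z| = 1
    & pi1 p%:R = 1].

Definition automodel (rho : Qp p -> R[i]) : Prop :=
  (forall z, z != 0 -> {for z, continuous rho}) /\
  exists (alpha : R[i]) (pi1 : Qp p -> R[i]), unitary_char pi1 /\
    forall z, z != 0 ->
      rho (t * z) / rho t @[t --> Qp_infty p] -->
        cpow (Qp_abs R z) (alpha - 1) * pi1 z.

End Automodel.

Section Lizorkin.
Variables (R : realType) (p n : nat).
Variable mu : {measure set (borel_Qpn p n) -> \bar R}.
Notation V := 'rV[Qp p]_n.
Implicit Types (phi psi : V -> R[i]) (a alpha beta : R[i]).

Definition normalized_haar : Prop :=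
  (forall (A : set (borel_Qpn p n)) (v : V),
     measurable A -> mu [set (v + x : V) | x in A] = mu A) /\
  mu (@unit_ball p n) = 1%E.

Definition test_fun : set (V -> R[i]) :=
  [set phi : V -> R[i] |
    (forall x : V, \forall y \near x, phi y = phi x) /\
    compact (closure [set x : V | phi x != 0])].

Definition fourier phi : V -> R[i] :=
  fun xi => cintegral mu setT (fun x => Qp_char R xi x * phi x).

Definition lizorkin_psi : set (V -> R[i]) :=
  [set psi : V -> R[i] | test_fun psi /\ psi 0 = 0].

Definition lizorkin_phi : set (V -> R[i]) := fourier @` lizorkin_psi.

(* A functional on Phi is given as a function on all of V -> C which is linear
   on Phi; its values outside Phi are irrelevant. *)
Definition lizorkin_dual (f : (V -> R[i]) -> R[i]) : Prop :=
  forall c phi psi, lizorkin_phi phi -> lizorkin_phi psi ->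
    f (fun x => c * phi x + psi x) = c * f phi + f psi.

Definition riesz_pole (j : int) : R[i] := 0 +i* (2 * pi / ln p%:R * j%:~R).

Definition padic_Gamma a : R[i] :=
  (1 - cpow p%:R (a - n%:R)) / (1 - cpow p%:R (- a)).

(* In both integrals the point x = 0, where [ln 0 = 0], is negligible. *)
Definition abs_pow_pairing a phi : R[i] :=
  cintegral mu (@unit_ball p n)
    (fun x => cpow (Qpn_abs R x) (a - n%:R) * (phi x - phi 0)) +
  cintegral mu (~` @unit_ball p n)
    (fun x => cpow (Qpn_abs R x) (a - n%:R) * phi x) +
  phi 0 * ((1 - cpow p%:R (- n%:R)) / (1 - cpow p%:R (- a))).

(* [- (1 - p^-n) / ln p * ln |x|] is the Riesz kernel of order n: the quotient
   of logarithms does not depend on their base. *)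
Definition riesz_pairing a phi : R[i] :=
  if `[< exists j, a = riesz_pole j >] then phi 0
  else if `[< exists j, a = n%:R + riesz_pole j >] then
    cintegral mu setT (fun x =>
      (- (1 - p%:R ^- n) / ln p%:R * ln (Qpn_abs R x))%:C * phi x)
  else abs_pow_pairing a phi / padic_Gamma a.

Definition taibleson alpha phi : V -> R[i] :=
  fun x => riesz_pairing (- alpha) (fun xi => phi (x - xi)).

Definition taibleson_dual alpha (f : (V -> R[i]) -> R[i]) :
    (V -> R[i]) -> R[i] :=
  fun phi => f (taibleson alpha phi).

Definition dilate (t : Qp p) (f : (V -> R[i]) -> R[i]) : (V -> R[i]) -> R[i] :=
  fun phi => (Qp_abs R t ^- n)%:C * f (fun x => phi (t^-1 *: x)).

Definition quasi_asymp (f g : (V -> R[i]) -> R[i]) (rho : Qp p -> R[i]) : Prop :=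
  (exists2 phi, lizorkin_phi phi & g phi != 0) /\
  forall phi, lizorkin_phi phi ->
    dilate t f phi / rho t @[t --> Qp_infty p] --> g phi.

End Lizorkin.

(* Main.v *)
(** Write [e(b,N)] for the character [x |-> chi_p(b.x)] cut off to the ball of
    radius [p^N].  A test function that vanishes at 0 is a finite combination of
    indicators of balls of one radius [p^-N] that avoid 0, so the space Phi is
    spanned by the [e(b,N)] with [|b| > p^-N].  Each of these is an
    eigenfunction, [D^alpha e(b,N) = |b|^alpha e(b,N)]: inside the ball of
    radius [p^N] this is the value of the Riesz kernel on [e(-b,N)], a
    telescoping sum over spheres (a geometric series for the logarithmic
    kernel), and outside it the kernel is constant on the relevant ball, over
    which the character has integral 0.  Hence [D^alpha] maps Phi onto Phi and
    satisfies [D^alpha (phi(./t)) = |t|^-alpha (D^alpha phi)(./t)], which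
    transports the asymptotics in both directions. *)

Require Import Defs.
From HB Require Import structures.
From mathcomp Require Import all_boot all_order all_algebra ring_quotient.
From mathcomp Require Import complex ring zify.
From mathcomp Require Import all_classical all_reals all_analysis.
From mathcomp Require Import measurable_realfun.
Set Implicit Arguments.
Unset Strict Implicit.
Unset Printing Implicit Defensive.
Import Order.TTheory GRing.Theory Num.Theory.
Import numFieldNormedType.Exports.
Local Open Scope classical_set_scope.
Local Open Scope ring_scope.

(** * The p-adic norm *)

Section QpNorm.
Local Open Scope quotient_scope.
Variable p : nat.
Implicit Types x y : Qp p.

(** On the Fourier side D^alpha is multiplication by |b|^alpha. The condition psi(0) = 0 excludes
    the frequency b = 0, so this factor is defined and nonzero for every complex alpha, and
    D^(-alpha) inverts D^alpha on Phi. Dilation by t replaces b by b/t, and |b/t|^alpha =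
    |t|^(-alpha) |b|^alpha is the origin of the factor in the new scale. The obstacle is that
    D^alpha is given not as a multiplier but by a kernel with three cases, one of them regularized
    at 0, and the multiplier has to be computed in each. Step functions keep this finite: nonzero
    norms are powers of p, a radial weight times a step function that vanishes near 0 is again a
    step function, and its integral is a finite combination of ball volumes p^(nk), which follow
    from translation invariance and the volume of the unit ball. The only integrand outside this
    class is the logarithm near 0, where monotone convergence takes over. *)

Lemma Qp_norm_repr x :
  (fun n => padic_norm p (repr x n) : rat^o) @ \oo --> (Qp_norm x : rat^o).
Proof. by rewrite -{2}[x]reprK; exact: Qp_norm_cvg. Qed.

Lemma Qp_norm_ge0 x : 0 <= Qp_norm x.
Proof.
apply: ler_cvg_to (cvg_cst (0 : rat^o)) (@Qp_norm_repr x) _.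
by near=> n; exact: padic_norm_ge0.
Unshelve. all: by end_near. Qed.

Lemma Qp_norm_eq0 x : (Qp_norm x == 0) = (x == 0).
Proof.
apply/eqP/eqP => [x0|->]; last exact: Qp_norm0.
apply/eqP; rewrite -[x]reprK Qp_pi_eq0; apply/asboolP => e e0.
have /cvgrPdist_lt/(_ e e0)[N _ hN] := @Qp_norm_repr x.
exists N => n Nn; have := hN n Nn; rewrite x0 sub0r normrN.
by rewrite ger0_norm // padic_norm_ge0.
Qed.

Lemma Qp_normM x y : Qp_norm (x * y) = Qp_norm x * Qp_norm y.
Proof.
rewrite -[x]reprK -[y]reprK -pi_mulr.
have h := @Qp_norm_cvg p (repr x * repr y).
have h' := cvgM (@Qp_norm_cvg p (repr x)) (@Qp_norm_cvg p (repr y)).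
apply: (cvg_unique (@norm_hausdorff _ rat^o) h).
rewrite (_ : (fun n => _) = (fun n => padic_norm p (repr x n) : rat^o) *
  (fun n => padic_norm p (repr y n) : rat^o)); first exact: h'.
by apply/funext => n; rewrite padic_normM.
Qed.

Lemma Qp_norm1 : Qp_norm (1 : Qp p) = 1.
Proof. by rewrite -(rmorph1 (Qp_of_rat p)) fmorph_eq_rat Qp_norm_ratr padic_norm1. Qed.

Lemma Qp_normV x : Qp_norm x^-1 = (Qp_norm x)^-1.
Proof.
have [->|x0] := eqVneq x 0; first by rewrite invr0 Qp_norm0 invr0.
apply: (@mulfI _ (Qp_norm x)); first by rewrite Qp_norm_eq0.
by rewrite -Qp_normM !divff ?Qp_norm1 // Qp_norm_eq0.
Qed.

Lemma Qp_norm_ultra x y :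
  Qp_norm (x + y) <= Num.max (Qp_norm x) (Qp_norm y).
Proof.
(* With a slack [e] the inequality between rational terms passes to the limit one norm at a time. *)
apply/ler_addgt0Pr => e e0.
rewrite -[x in leLHS]reprK -[y in leLHS]reprK -pi_addr.
apply: ler_cvg_to (@Qp_norm_cvg p _) (cvg_cst (_ : rat^o)) _.
near=> n; apply: le_trans (padic_norm_ultra _ _ _) _.
rewrite ge_max; apply/andP; split.
  apply: (@le_trans _ _ (Qp_norm x + e)); last by rewrite lerD2r le_max lexx.
  rewrite -lerBlDl; apply: le_trans (ler_norm _) _; rewrite distrC; apply: ltW.
  by near: n; have /cvgrPdist_lt := @Qp_norm_repr x; apply.
apply: (@le_trans _ _ (Qp_norm y + e)); last by rewrite lerD2r le_max lexx orbT.
rewrite -lerBlDl; apply: le_trans (ler_norm _) _; rewrite distrC; apply: ltW.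
by near: n; have /cvgrPdist_lt := @Qp_norm_repr y; apply.
Unshelve. all: by end_near. Qed.

Lemma Qp_norm_le_add x y e : Qp_norm x <= e -> Qp_norm y <= e -> Qp_norm (x + y) <= e.
Proof. by move=> xe ye; rewrite (le_trans (Qp_norm_ultra _ _)) // ge_max xe. Qed.

Lemma Qp_norm_distC x y : Qp_norm (x - y) = Qp_norm (y - x).
Proof. by rewrite -Qp_normN opprB. Qed.

Lemma Qp_norm_le_sub x y e : Qp_norm x <= e -> Qp_norm y <= e -> Qp_norm (x - y) <= e.
Proof. by move=> xe ye; apply: Qp_norm_le_add; rewrite ?Qp_normN. Qed.

Lemma pi_sub_ratr (u : cauchy_seq p) (q : rat) :
  \pi_(Qp p) u - ratr q = \pi_(Qp p) (u - CauchySeq (padic_cauchy_cst p q)).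
Proof. by rewrite -(fmorph_eq_rat (Qp_of_rat p)) pi_addr pi_oppr. Qed.

Lemma Qp_norm_pi_le (u : cauchy_seq p) (e : rat) N :
  (forall n, (N <= n)%N -> padic_norm p (u n) <= e) ->
  Qp_norm (\pi_(Qp p) u) <= e.
Proof.
move=> h; apply: ler_cvg_to (@Qp_norm_cvg p u) (cvg_cst (e : rat^o)) _.
by near=> n; apply: h; near: n; exact: nbhs_infty_ge.
Unshelve. all: by end_near. Qed.

(** A late term of a Cauchy sequence approximates its class. *)
Lemma Qp_dense x (e : rat) : 0 < e -> exists q : rat, Qp_norm (x - ratr q) <= e.
Proof.
move=> e0; have [N hN] := cauchy_seqP (repr x) e0; exists (repr x N).
rewrite -[x in x - _]reprK pi_sub_ratr; apply: (@Qp_norm_pi_le _ _ N) => n Nn.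
exact/ltW/hN.
Qed.

(** Ultrametric triangles are isosceles: |y| <= max(|x|, |x - y|), and the second entry is too small
    to bound |y|. *)
Lemma Qp_norm_dom x y : Qp_norm (x - y) < Qp_norm y -> Qp_norm x = Qp_norm y.
Proof.
move=> h; apply/eqP; rewrite eq_le; apply/andP; split.
  rewrite -{1}(subrK y x) (le_trans (Qp_norm_ultra _ _)) //.
  by rewrite ge_max lexx ltW.
have := Qp_norm_ultra x (y - x).
rewrite addrC subrK -(Qp_normN (y - x)) opprB le_max.
by rewrite (leNgt _ (_ (x - y))) h orbF.
Qed.

Lemma padic_normX q : prime p -> q != 0 -> exists k : int, padic_norm p q = p%:R ^ k.
Proof. by move=> pp q0; rewrite /padic_norm (negPf q0); eexists. Qed.

(** A rational within |x|/2 of x has exactly the norm of x, and nonzero rationals have norm a power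
    of p. *)
Lemma Qp_norm_val x : prime p -> x != 0 -> exists k : int, Qp_norm x = p%:R ^ k.
Proof.
move=> pp; rewrite -Qp_norm_eq0 => x0.
have nx0 : 0 < Qp_norm x by rewrite lt_def x0 Qp_norm_ge0.
have [q hq] := Qp_dense x (divr_gt0 nx0 (ltr0Sn _ 1)).
have xq : Qp_norm (ratr q - x) < Qp_norm x.
  rewrite -Qp_normN opprB (le_lt_trans hq) //.
  by rewrite ltr_pdivrMr // ltr_pMr // ltr1n.
rewrite -(Qp_norm_dom xq) Qp_norm_ratr; apply: padic_normX => //.
by rewrite -(padic_norm_eq0 p) -Qp_norm_ratr (Qp_norm_dom xq).
Qed.

End QpNorm.

(** * Rationals whose denominator is a power of p *)

Section FractionalPart.
Variable p : nat.
Hypothesis pp : prime p.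

Let p0 : (p%:R : rat) != 0. Proof. by rewrite pnatr_eq0 -lt0n prime_gt0. Qed.

(** Membership in Z[1/p], where fractional parts live. *)
Definition pfrac (r : rat) := exists k : nat, r * p%:R ^+ k \is a Num.int.

Lemma pfracD r s : pfrac r -> pfrac s -> pfrac (r + s).
Proof.
move=> [k hk] [l hl]; exists (k + l)%N; rewrite mulrDl exprD mulrA.
by rewrite (mulrC (_ ^+ k)) (mulrA s) rpredD // rpredM // rpredX // rpred_nat.
Qed.

Lemma pfracN r : pfrac r -> pfrac (- r).
Proof. by move=> [k hk]; exists k; rewrite mulNr rpredN. Qed.

Lemma pfrac_int r : r \is a Num.int -> pfrac r.
Proof. by exists 0%N; rewrite expr0 mulr1. Qed.

Lemma pfracMp r (k : nat) : pfrac r -> pfrac (p%:R ^+ k * r).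
Proof.
by move=> [l hl]; exists l; rewrite -mulrA rpredM // rpredX // rpred_nat.
Qed.

Lemma padic_norm_int (z : int) : padic_norm p z%:~R <= 1.
Proof.
have [->|z0] := eqVneq z 0; first by rewrite padic_norm0.
rewrite -[z%:~R]divr1 (@padic_normE p z 1) // logn1 sub0r.
by rewrite -invr_expz invf_le1 ?exprn_gt0 ?exprn_ege1 ?ler1n ?ltr0n ?prime_gt0.
Qed.

(** Z[1/p] meets Z_p in Z: the norm bound makes p^k divide the numerator over p^k. *)
Lemma pfrac_norm_int r : pfrac r -> padic_norm p r <= 1 -> r \is a Num.int.
Proof.
move=> [k /intrP[z hz]] nr.
have pk0 : (p ^ k)%N%:Z != 0 by rewrite eqz_nat -lt0n expn_gt0 prime_gt0.
have er : r = z%:~R / (p ^ k)%N%:Z%:~R.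
  by rewrite -hz -natrX mulfK // pnatr_eq0 -lt0n expn_gt0 prime_gt0.
have [z0|z0] := eqVneq z 0; first by rewrite er z0 mul0r rpred0.
move: nr; rewrite er padic_normE // absz_nat pfactorK //.
rewrite -(expr0z p%:R) ler_eXz2l ?ltr1n ?prime_gt1 // subr_le0 lez_nat.
rewrite -pfactor_dvdn ?absz_gt0 // => d.
have /dvdzP[w ->] : ((p ^ k)%N%:Z %| z)%Z by rewrite dvdzE.
by rewrite intrM mulfK ?rpred_int // intr_eq0.
Qed.

(** Partial fractions: the denominator is b p^k with b prime to p, and u b + v p^k = 1 splits z/(b
    p^k) into zu/p^k, kept as [r], and zv/b, which is p-integral. *)
Lemma pfrac_approx_rat (q : rat) : exists2 r, pfrac r & padic_norm p (q - r) <= 1.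
Proof.
set d := `|denq q|%N; set k := logn p d; set b := (d %/ p ^ k)%N.
have d0 : (0 < d)%N by rewrite absz_gt0 denq_neq0.
have db : (b * p ^ k)%N = d by rewrite divnK // pfactor_dvdnn.
have b0 : (0 < b)%N by case: (posnP b) d0 => // b0; rewrite -db b0 mul0n.
have cb : coprime b (p ^ k).
  rewrite coprime_sym; apply: coprimeXl; rewrite prime_coprime //.
  apply/negP => hb; have : (p ^ k.+1 %| d)%N by rewrite -db expnS dvdn_mul.
  by rewrite pfactor_dvdn // ltnn.
have [u [v uv]] : exists u v : int, u * b%:Z + v * (p ^ k)%N%:Z = 1.
  have /coprimezP[[u v] /= uv] : coprimez b%:Z (p ^ k)%N%:Z by [].
  by exists u, v.
have bQ : (b%:R : rat) != 0 by rewrite pnatr_eq0 -lt0n.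
have pQ : (p ^ k)%N%:R != 0 :> rat by rewrite pnatr_eq0 -lt0n expn_gt0 prime_gt0.
have eq : q = (numq q)%:~R / (b%:R * (p ^ k)%N%:R).
  rewrite -natrM db -[LHS]divq_num_den; congr (_ / _).
  by rewrite -[RHS]/((`|denq q|%N : int)%:~R) absz_denq.
clearbody d; move: (numq q) eq => z ->.
exists ((z * u)%:~R / (p ^ k)%N%:R).
  by exists k; rewrite -natrX mulfVK // rpred_int.
have -> : z%:~R / (b%:R * (p ^ k)%N%:R) - (z * u)%:~R / (p ^ k)%N%:R = (z * v)%:~R / b%:Z%:~R :> rat.
  have {uv} : u%:~R * b%:R + v%:~R * (p ^ k)%N%:R = 1 :> rat.
    by have := congr1 (intr : int -> rat) uv; rewrite intrD !intrM.
  move=> uv; rewrite !intrM -[b%:Z%:~R]/(b%:R).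
  transitivity (z%:~R * (u%:~R * b%:R + v%:~R * (p ^ k)%N%:R) /
    (b%:R * (p ^ k)%N%:R) - z%:~R * u%:~R / (p ^ k)%N%:R :> rat).
    by rewrite uv mulr1.
  by field; rewrite bQ pQ.
rewrite padic_normM padic_normV -[b%:Z%:~R]divr1.
have lb : logn p b = 0%N by rewrite /b logn_div ?pfactor_dvdnn // pfactorK // subnn.
rewrite (@padic_normE p b%:Z 1) //; last by rewrite eqz_nat -lt0n.
by rewrite logn1 absz_nat lb subrr expr0z invr1 mulr1 padic_norm_int.
Qed.

End FractionalPart.

Local Open Scope complex_scope.

(** * The complex exponential and its periods *)

Section ComplexExponential.
Variable R : realType.
Implicit Types (z w : R[i]) (r s : R).

Lemma cexpD z w : cexp (z + w) = cexp z * cexp w.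
Proof.
case: z w => [a b] [c d]; rewrite /cexp /= expRD cosD sinD.
by apply/eqP; rewrite eq_complex /=; apply/andP; split; apply/eqP; ring.
Qed.

Lemma cexp0 : cexp (0 : R[i]) = 1.
Proof. by rewrite /cexp /= expR0 cos0 sin0 mul1r. Qed.

Lemma cexp_neq0 z : cexp z != 0.
Proof.
apply/eqP => h; have : cexp z * cexp (- z) = 1 by rewrite -cexpD subrr cexp0.
by rewrite h mul0r => /eqP; rewrite eq_sym oner_eq0.
Qed.

Definition ce r : R[i] := cexp (0 +i* (2 * pi * r)).

Lemma ceD r s : ce (r + s) = ce r * ce s.
Proof. by rewrite /ce -cexpD; congr cexp; rewrite /= mulrDr; simpc. Qed.

Lemma ce0 : ce 0 = 1.
Proof. by rewrite /ce mulr0 cexp0. Qed.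

Lemma ce_nat k : ce k%:R = 1.
Proof.
elim: k => [|k ih]; first exact: ce0.
rewrite -natr1 ceD ih mul1r /ce /cexp /= expR0 mulr1 mul1r.
by rewrite mulr_natl -[pi *+ 2]add0r cosD2pi sinD2pi cos0 sin0.
Qed.

Lemma ce_int r : r \is a Num.int -> ce r = 1.
Proof.
move=> /intrP[[k|k] ->]; first exact: ce_nat.
apply: (mulIf (cexp_neq0 (0 +i* (2 * pi * k.+1%:R)))).
rewrite -[cexp _ in LHS]/(ce _) -ceD mul1r NegzE.
by rewrite mulrNz -[X in _ + X]/(k.+1%:~R) addNr ce0 -[RHS]/(ce _) ce_nat.
Qed.

Lemma cexp_eq1 z : cexp z = 1 -> exists j : int, z = 0 +i* (2 * pi * j%:~R).
Proof.
case: z => a b; rewrite /cexp /= => /eqP; rewrite eq_complex /=.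
rewrite !mul0r subr0 addr0 => /andP[/eqP hc /eqP hs].
have e0 := expR_gt0 a.
have s0 : sin b = 0 by apply/eqP; move/eqP: hs; rewrite mulf_eq0 gt_eqF.
have c2 : cos b ^+ 2 = 1 by have := cos2Dsin2 b; rewrite s0 expr0n addr0.
(* The value -1 is excluded because exp(a) cos(b) = 1 with exp(a) > 0. *)
have c1 : cos b = 1.
  move/eqP: c2; rewrite sqrf_eq1 => /orP[/eqP //|/eqP c1].
  by move: hc; rewrite c1 mulrN1 => h; have := e0; rewrite -oppr_lt0 h ltr10.
have a0 : a = 0.
  by apply: (@expR_inj R); rewrite expR0 -hc c1 mulr1.
have P0 : 0 < 2 * pi :> R by rewrite mulr_gt0 // pi_gt0.
(* The angle is reduced to r in [0, 2 pi), still with cosine 1. Injectivity of the cosine on [0, pi]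
   then applies to r, or to 2 pi - r when r > pi; the latter would give r = 2 pi. *)
exists (Num.floor (b / (2 * pi))); rewrite a0; congr (_ +i* _).
set j := Num.floor _; pose r := b - 2 * pi * j%:~R.
have /andP[r0 r1] : 0 <= r < 2 * pi.
  have /andP[h1 h2] := floor_itv (b / (2 * pi)).
  rewrite /r subr_ge0 ltrBlDr mulrC -ler_pdivlMr // h1 /=.
  rewrite -[X in _ < X + _]mul1r -mulrDl -ltr_pdivrMr //.
  by rewrite (lt_le_trans h2) // -/j intrD addrC.
have cr : cos r = 1.
  have : ce (b / (2 * pi)) = 1.
    by rewrite /ce mulrCA divff ?gt_eqF // mulr1 /cexp /= expR0 c1 s0 mul1r.
  rewrite (_ : b / (2 * pi) = r / (2 * pi) + j%:~R); last first.
    by rewrite /r mulrBl [2 * pi * _]mulrC mulfK ?gt_eqF // subrK.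
  rewrite ceD (ce_int (intr_int _ _)) mulr1 /ce mulrCA divff ?gt_eqF // mulr1.
  by rewrite /cexp /= expR0 mul1r => -[].
have pi0 : 0 \in `[0, (pi : R)] by rewrite in_itv /= lexx pi_ge0.
suff : r = 0 by move=> h; apply/eqP; rewrite -subr_eq0 -/r h.
have [rp|rp] := leP r pi.
  by apply: cos_inj; rewrite ?cr ?cos0 // in_itv /= r0 rp.
have : 2 * pi - r = 0.
  apply: cos_inj => //.
    rewrite in_itv /= subr_ge0 (ltW r1) /= lerBlDr mulr_natl mulr2n lerD2l.
    exact: ltW.
  rewrite cos0 addrC mulr_natl cosD2pi cosN.
  by [].
by move/eqP; rewrite subr_eq0 => /eqP h; rewrite -h ltxx in r1.
Qed.

Lemma ce_eq1 r : ce r = 1 -> r \is a Num.int.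
Proof.
move=> /cexp_eq1[j [/mulfI]]; rewrite mulf_neq0 ?gt_eqF ?pi_gt0 // => -> //.
Qed.

End ComplexExponential.

(* Otherwise unification unfolds the quotient defining Qp when it compares
   p-adic expressions. *)
Opaque Qp_norm padic_norm Qp_frac.

(** * Fractional parts and residues of p-adic numbers *)

Section Fraction.
Variable p : nat.
Hypothesis pp : prime p.
Implicit Types (x y : Qp p) (q r : rat).

Let pQ : (p%:R : rat) != 0. Proof. by rewrite pnatr_eq0 -lt0n prime_gt0. Qed.

Lemma ratr_sub_Qp (q r : rat) : ratr q - ratr r = ratr (q - r) :> Qp p.
Proof. by rewrite -!(fmorph_eq_rat (Qp_of_rat p)) rmorphB. Qed.

Lemma ratr_natr_Qp (m : nat) : ratr m%:R = m%:R :> Qp p.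
Proof. by rewrite -(fmorph_eq_rat (Qp_of_rat p)) rmorph_nat. Qed.

Lemma Qp_approx x : exists2 r : rat, pfrac p r & Qp_norm (x - ratr r) <= 1.
Proof.
have [q hq] := Qp_dense x ltr01; have [r hr qr] := pfrac_approx_rat pp q.
exists r; first exact: hr.
rewrite -[x](subrK (ratr q)) -addrA ratr_sub_Qp.
by apply: Qp_norm_le_add hq _; rewrite Qp_norm_ratr.
Qed.

(** The difference lies in Z[1/p] and in Z_p. This one fact makes the fractional part unique, and
    additive modulo Z. *)
Lemma Qp_norm_le_int (x : Qp p) q r : pfrac p q -> pfrac p r ->
  Qp_norm (x - ratr q) <= 1 -> Qp_norm (x - ratr r) <= 1 -> q - r \is a Num.int.
Proof.
move=> hq hr xq xr; apply: (pfrac_norm_int pp); first exact/pfracD/pfracN.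
rewrite -Qp_norm_ratr -ratr_sub_Qp -[ratr q - _](subrKA x) addrC.
by apply: Qp_norm_le_add xr _; rewrite Qp_norm_distC.
Qed.

Lemma Qp_fracP x :
  [/\ 0 <= Qp_frac x < 1, pfrac p (Qp_frac x) & Qp_norm (x - ratr (Qp_frac x)) <= 1].
Proof.
Transparent Qp_frac.
rewrite /Qp_frac; apply: (@xgetPex _ 0 [set r : rat | [/\ 0 <= r < 1, _ & _]]).
(* Subtracting the floor normalizes the approximant to [0, 1) and moves it by an element of Z_p. *)
have [r hr xr] := Qp_approx x; exists (r - (Num.floor r)%:~R).
have fi : (Num.floor r)%:~R \is a @Num.int rat by exact: intr_int.
split.
- have /andP[h1 h2] := floor_itv r; rewrite subr_ge0 h1 /= ltrBlDr.
  by rewrite (lt_le_trans h2) // intrD addrC.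
- exact/pfracD/pfracN/pfrac_int.
rewrite -ratr_sub_Qp opprB addrCA; apply: Qp_norm_le_add xr.
by rewrite Qp_norm_ratr padic_norm_int.
Qed.

Lemma int_itv01_eq0 (r : rat) : r \is a Num.int -> -1 < r -> r < 1 -> r = 0.
Proof.
move=> /intrP[z ->]; rewrite -[-1]/((-1)%:~R) ltr_int ltrz1 => h1 h2.
by suff -> : z = 0 by []; lia.
Qed.

Lemma Qp_frac_unique x (r : rat) : 0 <= r < 1 -> pfrac p r ->
  Qp_norm (x - ratr r) <= 1 -> Qp_frac x = r.
Proof.
move=> /andP[r0 r1] hr xr; have [/andP[f0 f1] hf xf] := Qp_fracP x.
apply/eqP; rewrite -subr_eq0; apply/eqP/int_itv01_eq0.
- exact: Qp_norm_le_int xf xr.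
- by rewrite ltrBrDl (lt_le_trans _ f0) // subr_lt0.
- by rewrite ltrBlDl (lt_le_trans f1) // lerDr.
Qed.

Lemma Qp_frac0 x : Qp_norm x <= 1 -> Qp_frac x = 0.
Proof.
move=> x1; apply: Qp_frac_unique; rewrite ?lexx ?ltr01 //.
  by apply: pfrac_int; rewrite rpred0.
by rewrite -(fmorph_eq_rat (Qp_of_rat p)) rmorph0 subr0.
Qed.

Lemma Qp_fracD x y : Qp_frac (x + y) - (Qp_frac x + Qp_frac y) \is a Num.int.
Proof.
have [_ hx nx] := Qp_fracP x; have [_ hy ny] := Qp_fracP y.
have [_ hxy nxy] := Qp_fracP (x + y).
apply: (Qp_norm_le_int hxy (pfracD hx hy) nxy).
rewrite -(fmorph_eq_rat (Qp_of_rat p)) rmorphD !fmorph_eq_rat opprD addrACA.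
exact: Qp_norm_le_add nx ny.
Qed.

Lemma Qp_frac_invp : Qp_frac (p%:R^-1 : Qp p) = p%:R^-1.
Proof.
apply: Qp_frac_unique.
- by rewrite invr_ge0 ler0n /= invf_lt1 ?ltr1n ?prime_gt1 // ltr0n prime_gt0.
- by exists 1%N; rewrite expr1 mulVf.
- by rewrite -(fmorph_eq_rat (Qp_of_rat p)) fmorphV rmorph_nat subrr Qp_norm0.
Qed.

Lemma Qp_norm_ppow (k : int) : Qp_norm (p%:R ^ k : Qp p) = p%:R ^ (- k).
Proof.
have e j : Qp_norm (p%:R ^+ j : Qp p) = p%:R ^- j.
  elim: j => [|j ih]; first by rewrite !expr0 Qp_norm1 invr1.
  by rewrite exprS Qp_normM ih Qp_norm_p // exprS invfM.
case: k => k; first by rewrite -exprnP e -exprnN.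
by rewrite NegzE -exprnN Qp_normV e opprK invrK -exprnP.
Qed.

(** The residue of x modulo p^j is p^j times the fractional part of x / p^j: that product is in
    Z[1/p] and in Z_p, hence an integer, and it lies in [0, p^j). *)
Lemma digitP (x : Qp p) (j : nat) : Qp_norm x <= 1 ->
  exists2 c : 'I_(p ^ j), Qp_norm (x - (c : nat)%:R) <= p%:R ^- j &
    forall c' : 'I_(p ^ j), Qp_norm (x - (c' : nat)%:R) <= p%:R ^- j -> c' = c.
Proof.
move=> x1; pose y := x / p%:R ^+ j.
have Pj0 : (p%:R ^+ j : rat) != 0 by rewrite expf_neq0.
have Pj : 0 < (p%:R ^+ j : rat) by rewrite lt_def Pj0 exprn_ge0.
have nPj : Qp_norm (p%:R ^+ j : Qp p) = p%:R ^- j.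
  by have := Qp_norm_ppow j; rewrite -exprnP -exprnN.
have QPj0 : (p%:R ^+ j : Qp p) != 0.
  by rewrite -Qp_norm_eq0 nPj invr_eq0.
have rP (r : rat) : ratr (p%:R ^+ j * r) = p%:R ^+ j * ratr r :> Qp p.
  by rewrite -!(fmorph_eq_rat (Qp_of_rat p)) rmorphM rmorphXn rmorph_nat.
have key r : (Qp_norm (x - ratr (p%:R ^+ j * r)) <= p%:R ^- j) =
    (Qp_norm (y - ratr r) <= 1).
  rewrite (_ : x - _ = p%:R ^+ j * (y - ratr r)).
    by rewrite Qp_normM nPj ler_pdivrMl // divff.
  by rewrite mulrBr rP /y [_ * (x / _)]mulrC divfK.
have [/andP[r0 r1] hr yr] := Qp_fracP y; set r := Qp_frac y in r0 r1 hr yr.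
have : p%:R ^+ j * r \is a Num.int.
  apply: (pfrac_norm_int pp); first exact: pfracMp.
  rewrite -Qp_norm_ratr -[ratr _](subKr x); apply: Qp_norm_le_sub x1 _.
  rewrite -key in yr; apply: le_trans yr _.
  by rewrite invf_le1 // exprn_ege1 // ler1n prime_gt0.
rewrite intrEge0 ?mulr_ge0 ?exprn_ge0 // => /natrP[c hc].
have cp : (c < p ^ j)%N.
  by rewrite -(ltr_nat rat) -hc natrX -[ltRHS]mulr1 ltr_pM2l.
exists (Ordinal cp) => [|c' hc'] /=; first by rewrite -ratr_natr_Qp -hc key.
apply: val_inj => /=; apply/eqP; rewrite -(eqr_nat rat) -hc.
suff -> : r = c'%:R / p%:R ^+ j by rewrite mulrC divfK.
apply: Qp_frac_unique.
- by rewrite divr_ge0 ?exprn_ge0 //= ltr_pdivrMr // mul1r -natrX ltr_nat.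
- by exists j; rewrite divfK // rpred_nat.
- by rewrite -key mulrC divfK ?ratr_natr_Qp.
Qed.

End Fraction.

(** * Balls and characters *)

Opaque Qp_frac.

Section Balls.
Variables (p n : nat).
Hypothesis pp : prime p.
Notation V := 'rV[Qp p]_n.
Implicit Types (x y a b : V) (k l : int) (t : Qp p).

Definition prad k : rat := p%:R ^ k.

Lemma prad_gt0 k : 0 < prad k.
Proof. by rewrite exprz_gt0 // ltr0n prime_gt0. Qed.

Lemma prad_le k l : (prad k <= prad l) = (k <= l).
Proof. by rewrite ler_eXz2l // ltr1n prime_gt1. Qed.

Lemma prad_lt k l : (prad k < prad l) = (k < l).
Proof. by rewrite ltr_eXz2l // ltr1n prime_gt1. Qed.

Lemma pradD k l : prad (k + l) = prad k * prad l.
Proof. by rewrite /prad expfzDr // pnatr_eq0 -lt0n prime_gt0. Qed.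

Lemma prad0 : prad 0 = 1. Proof. by []. Qed.

Lemma pradN k : prad (- k) = (prad k)^-1.
Proof. by rewrite /prad invr_expz. Qed.

Lemma prad_small (e : rat) : 0 < e -> exists k, prad k < e.
Proof.
move=> e0; pose m := Num.truncn (e^-1); exists (- m.+1%:Z).
rewrite pradN -[ltRHS]invrK ltf_pV2 ?posrE ?invr_gt0 ?prad_gt0 //.
apply: lt_trans (truncnS_gt _) _; rewrite -/m /prad -exprnP -natrX ltr_nat.
exact/ltn_expl/prime_gt1.
Qed.

Definition inball k x := Qpn_norm x <= prad k.

Lemma Qpn_norm_leP (e : rat) x : 0 <= e ->
  reflect (forall j, Qp_norm (x 0 j) <= e) (Qpn_norm x <= e).
Proof.
move=> e0; apply: (iffP (bigmax_leP _ _ _ _)) => [[_ h] j|h]; first exact: h.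
by split=> // j _; exact: h.
Qed.

Lemma inballP k x : reflect (forall j, Qp_norm (x 0 j) <= prad k) (inball k x).
Proof. exact/Qpn_norm_leP/ltW/prad_gt0. Qed.

Lemma Qpn_norm_ge x j : Qp_norm (x 0 j) <= Qpn_norm x.
Proof. exact: le_bigmax. Qed.

Lemma Qpn_norm_ge0 x : 0 <= Qpn_norm x.
Proof. exact: bigmax_ge_id. Qed.

Lemma Qpn_norm0 : Qpn_norm (0 : V) = 0.
Proof.
apply/le_anti; rewrite Qpn_norm_ge0 andbT; apply/Qpn_norm_leP => // j.
by rewrite mxE Qp_norm0.
Qed.

Lemma Qpn_norm_eq0 x : (Qpn_norm x == 0) = (x == 0).
Proof.
apply/eqP/eqP => [x0|->]; last exact: Qpn_norm0.
apply/rowP => j; rewrite mxE; apply/eqP; rewrite -Qp_norm_eq0.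
by apply/eqP/le_anti; rewrite Qp_norm_ge0 -x0 Qpn_norm_ge.
Qed.

Lemma Qpn_normN x : Qpn_norm (- x) = Qpn_norm x.
Proof. by apply: eq_bigr => j _; rewrite mxE Qp_normN. Qed.

Lemma Qpn_normZ t x : Qpn_norm (t *: x) = Qp_norm t * Qpn_norm x.
Proof.
have [->|t0] := eqVneq t 0; first by rewrite scale0r Qpn_norm0 Qp_norm0 mul0r.
have t1 : 0 < Qp_norm t by rewrite lt_def Qp_norm_eq0 t0 Qp_norm_ge0.
apply/le_anti/andP; split.
  apply/Qpn_norm_leP => [|j]; first by rewrite mulr_ge0 ?Qpn_norm_ge0 // ltW.
  by rewrite mxE Qp_normM ler_pM2l // Qpn_norm_ge.
rewrite mulrC -ler_pdivlMr //; apply/Qpn_norm_leP => [|j].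
  by rewrite divr_ge0 ?Qpn_norm_ge0 // ltW.
rewrite ler_pdivlMr // mulrC -Qp_normM.
by have := Qpn_norm_ge (t *: x) j; rewrite mxE.
Qed.

Lemma Qpn_norm_val x : x != 0 -> exists k, Qpn_norm x = prad k.
Proof.
move=> x0; have : Qpn_norm x != 0 by rewrite Qpn_norm_eq0.
rewrite /Qpn_norm; elim/big_ind: _ => [/eqP//|u v hu hv|j _].
  by rewrite /Order.max; case: ifP => _; [exact: hv | exact: hu].
by rewrite Qp_norm_eq0 => /(Qp_norm_val pp).
Qed.

Lemma inball0 k : inball k 0.
Proof. by rewrite /inball Qpn_norm0 ltW // prad_gt0. Qed.

Lemma inballN k x : inball k (- x) = inball k x.
Proof. by rewrite /inball Qpn_normN. Qed.

Lemma inballD k x y : inball k x -> inball k y -> inball k (x + y).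
Proof.
move=> /inballP hx /inballP hy; apply/inballP => j; rewrite mxE.
by apply: Qp_norm_le_add (hx j) (hy j).
Qed.

Lemma inballB k x y : inball k x -> inball k y -> inball k (x - y).
Proof. by move=> hx hy; rewrite inballD ?inballN. Qed.

Lemma inballDr k x y : inball k y -> inball k (x + y) = inball k x.
Proof.
move=> hy; apply/idP/idP => h; last exact: inballD.
by rewrite -[x](addrK y) inballB.
Qed.

Lemma inball_distC k x y : inball k (x - y) = inball k (y - x).
Proof. by rewrite -inballN opprB. Qed.

Lemma inball_trans k y x z :
  inball k (x - y) -> inball k (y - z) -> inball k (x - z).
Proof. by move=> xy yz; rewrite -(subrKA y) inballD. Qed.

Lemma inball_le k l x : k <= l -> inball k x -> inball l x.
Proof. by move=> kl h; apply: le_trans h _; rewrite prad_le. Qed.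

Lemma inballZ k l t x : Qp_norm t = prad l -> inball (k + l) (t *: x) = inball k x.
Proof.
by move=> tl; rewrite /inball Qpn_normZ tl pradD mulrC ler_pM2r // prad_gt0.
Qed.

Lemma inball_prad k l x : Qpn_norm x = prad k -> inball l x = (k <= l).
Proof. by rewrite /inball => ->; rewrite prad_le. Qed.

Lemma inball_ex x : exists k, inball k x.
Proof.
have [->|/Qpn_norm_val[k hk]] := eqVneq x 0; first by exists 0; exact: inball0.
by exists k; rewrite (inball_prad _ hk).
Qed.

(** Representatives of the ball of radius p^k modulo the ball of radius p^(k-j). The factor p^(-k)
    has norm p^k, so it carries Z_p^n onto the larger ball and residues modulo p^j to cosets. *)
Definition coset_rep k (j : nat) (c : 'rV['I_(p ^ j)]_n) : V :=
  \row_i (p%:R ^ (- k) * (c 0 i : nat)%:R).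

Lemma inball_coset_rep k j x : inball k x ->
  exists2 c : 'rV['I_(p ^ j)]_n, inball (k - j%:Z) (x - coset_rep k c) &
    forall c', inball (k - j%:Z) (x - coset_rep k c') -> c' = c.
Proof.
move=> /inballP hx; pose y i := p%:R ^ k * x 0 i.
have pk : Qp_norm (p%:R ^ k : Qp p) = prad (- k) := Qp_norm_ppow pp k.
have pk0 : (p%:R ^ k : Qp p) != 0 by rewrite -Qp_norm_eq0 pk gt_eqF ?prad_gt0.
have key i (c : 'rV['I_(p ^ j)]_n) :
    (Qp_norm ((x - coset_rep k c) 0 i) <= prad (k - j%:Z)) =
    (Qp_norm (y i - (c 0 i : nat)%:R) <= p%:R ^- j).
  rewrite (_ : y i - _ = p%:R ^ k * ((x - coset_rep k c) 0 i)).
    rewrite Qp_normM pk pradN ler_pdivrMl ?prad_gt0 //.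
    by rewrite pradD pradN.
  by rewrite !mxE mulrBr -invr_expz mulVKf.
have y1 i : Qp_norm (y i) <= 1.
  by rewrite Qp_normM pk pradN ler_pdivrMl ?prad_gt0 // mulr1; exact: hx.
pose c : 'rV['I_(p ^ j)]_n := \row_i s2val (cid2 (digitP pp j (y1 i))).
exists c => [|c' /inballP hc'].
  by apply/inballP => i; rewrite key mxE; case: cid2.
apply/rowP => i; rewrite mxE; case: cid2 => /= d _; apply.
by rewrite -key.
Qed.

Lemma inball_coset_repk k j (c : 'rV['I_(p ^ j)]_n) : inball k (coset_rep k c).
Proof.
apply/inballP => i; rewrite mxE Qp_normM (Qp_norm_ppow pp) opprK.
rewrite -[leRHS]mulr1 ler_pM2l ?prad_gt0 // -ratr_natr_Qp Qp_norm_ratr.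
exact: (padic_norm_int pp (c 0 i : nat)%:Z).
Qed.

End Balls.

Section Characters.
Variables (R : realType) (p n : nat).
Hypothesis pp : prime p.
Notation V := 'rV[Qp p]_n.
Notation chi := (Qp_char R).
Implicit Types (x y a b : V) (k l : int) (t : Qp p).

Lemma QcharE a x : chi a x = ce (\sum_(j < n) ratr (Qp_frac (a 0 j * x 0 j))).
Proof. by []. Qed.

Lemma QcharC a x : chi a x = chi x a.
Proof. by rewrite !QcharE; congr ce; apply: eq_bigr => j _; rewrite mulrC. Qed.

(** Fractional parts add up to an integer error, which the exponential does not see. *)
Lemma QcharD a x y : chi a (x + y) = chi a x * chi a y.
Proof.
rewrite !QcharE -ceD; set u := \sum_(j < n) _; set v := _ + _.
rewrite -[u](subrK v) ceD ce_int ?mul1r // /u /v -big_split /= -sumrB.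
apply: rpred_sum => j _; rewrite mxE mulrDr -!rmorphD -rmorphB.
have /intrP[z ->] := Qp_fracD pp (a 0 j * x 0 j) (a 0 j * y 0 j).
by rewrite rmorph_int intr_int.
Qed.

Lemma Qchar_int a x : (forall j, Qp_norm (a 0 j * x 0 j) <= 1) -> chi a x = 1.
Proof.
by move=> h; rewrite QcharE big1 ?ce0 // => j _; rewrite (Qp_frac0 pp (h j)) rmorph0.
Qed.

Lemma Qchar0 a : chi a 0 = 1.
Proof. by apply: Qchar_int => j; rewrite mxE mulr0 Qp_norm0. Qed.

Lemma QcharNl a x : chi (- a) x = chi a (- x).
Proof.
by rewrite !QcharE; congr ce; apply: eq_bigr => j _; rewrite !mxE mulrN mulNr.
Qed.

Lemma QcharZ t a x : chi (t *: a) x = chi a (t *: x).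
Proof.
by rewrite !QcharE; congr ce; apply: eq_bigr => j _; rewrite !mxE mulrCA mulrA.
Qed.

Lemma Qchar_inball k a x : inball (- k) a -> inball k x -> chi a x = 1.
Proof.
move=> /(inballP pp) ha /(inballP pp) hx; apply: Qchar_int => j.
rewrite Qp_normM -(prad0 p) -(addNr k) (pradD pp).
by apply: ler_pM (ha j) (hx j); exact: Qp_norm_ge0.
Qed.

(** If |a_j| > p^(-k), the vector with single entry 1/(p a_j) has norm p/|a_j| <= p^k, by
    discreteness of the norm, and pairs with a to 1/p, so the character is exp(2 pi i/p) there. *)
Lemma Qchar_nontrivial k a : ~~ inball (- k) a ->
  exists2 b, inball k b & chi a b != 1.
Proof.
move=> /(inballP pp)/existsNP[j /negP]; rewrite -ltNge => aj.
have aj0 : a 0 j != 0.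
  by rewrite -Qp_norm_eq0 gt_eqF // (lt_trans (prad_gt0 pp _) aj).
have [m hm] := Qp_norm_val pp aj0.
pose b : V := \row_i (if i == j then (p%:R * a 0 j)^-1 else 0).
exists b.
  apply/(inballP pp) => i; rewrite mxE; case: eqP => _; last first.
    by rewrite Qp_norm0 ltW // prad_gt0.
  rewrite Qp_normV Qp_normM Qp_norm_p // hm invfM invrK.
  move: aj; rewrite hm -!/(prad p _) prad_lt // -pradN.
  rewrite -[p%:R]/(prad p 1) -pradD // prad_le // => h; lia.
rewrite QcharE (bigD1 j) //= big1 => [|i ij]; last first.
  by rewrite mxE (negPf ij) mulr0 Qp_frac0 ?rmorph0 // Qp_norm0.
rewrite mxE eqxx invfM mulrCA divff // mulr1 addr0 Qp_frac_invp //.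
apply/eqP => /ce_eq1; rewrite fmorphV rmorph_nat => /intrP[z hz].
have p0 : (0 < p%:R^-1 :> R) by rewrite invr_gt0 ltr0n prime_gt0.
have p1 : (p%:R^-1 < 1 :> R) by rewrite invf_lt1 ?ltr1n ?prime_gt1 // ltr0n prime_gt0.
by move: p0 p1; rewrite hz ltr0z ltrz1; lia.
Qed.

End Characters.

(** * Compactness of balls and step functions *)

Opaque inball.

Section Topology.
Variables (p n : nat).
Hypothesis pp : prime p.
Notation V := 'rV[Qp p]_n.
Implicit Types (x y a b : V) (k l : int) (t : Qp p).

Lemma nbhs_inball x (A : set V) :
  nbhs x A <-> exists k, forall y, inball k (x - y) -> A y.
Proof.
rewrite -nbhs_ballE; split=> [[e /= e0 sA]|[k sA]].
  have [k hk] := prad_small pp e0; exists k => y /(inballP pp) xy; apply: sA.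
  split=> // i j; rewrite (ord1 i); apply: le_lt_trans hk.
  by have := xy j; rewrite !mxE.
exists (prad p k) => [|y [_ xy]] /=; first exact: prad_gt0.
apply: sA; apply/(inballP pp) => j; rewrite !mxE; apply/ltW; exact: xy.
Qed.

Lemma open_inball k a : open [set x | inball k (x - a)].
Proof.
rewrite openE => x /= xa; apply/nbhs_inball; exists k => y; rewrite inball_distC.
by move=> xy /=; apply: inball_trans xy xa.
Qed.

Lemma closed_inball k : closed [set x : V | inball k x].
Proof.
rewrite -[X in closed X]setCK; apply: open_closedC; rewrite openE => x /= xk.
apply/nbhs_inball; exists k => y xy /= yk; apply: xk.
by rewrite -[x](subrK y); exact: inballD.
Qed.

(** The cosets are finite in number: if the ultrafilter contained none, it would contain all their
    complements, hence a point of the ball that is in no coset. *)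
Lemma ultra_coset (F : set_system V) k (j : nat) : UltraFilter F ->
  F [set x | inball k x] ->
  exists c : 'rV['I_(p ^ j)]_n, F [set x | inball (k - j%:Z) (x - coset_rep k c)].
Proof.
move=> FU Fk; apply: contrapT => /forallNP hc.
have : \forall x \near F, forall c : 'rV['I_(p ^ j)]_n,
    ~ inball (k - j%:Z) (x - coset_rep k c).
  apply: filter_forall => c; have := hc c.
  by case: (in_ultra_setVsetC [set x | inball (k - j%:Z) (x - coset_rep k c)] FU).
move=> hF; have [x [/= xk xc]] := filter_ex (filterI Fk hF).
by have [c hc' _] := inball_coset_rep pp j xk; case: (xc c).
Qed.

(* An ultrafilter selects one coset at each level; the representatives form a
   Cauchy sequence of rational vectors, whose class is the limit. *)
Lemma compact_inball k : compact [set x : V | inball k x].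
Proof.
rewrite compact_ultra => F FU Fk.
have /choice[c hc] : forall j, exists q : 'I_n -> rat,
    F [set x : V | inball (k - j%:Z) (x - \row_i ratr (q i))].
  move=> j; have [c hc] := ultra_coset j FU Fk.
  exists (fun i => p%:R ^ (- k) * (c 0 i : nat)%:R).
  apply: filterS hc => x /=; congr (is_true (inball _ (_ - _))).
  apply/rowP => i; rewrite !mxE.
  by rewrite -(fmorph_eq_rat (Qp_of_rat p)) rmorphM fmorphXz !rmorph_nat.
have dist j m i : (j <= m)%N -> padic_norm p (c m i - c j i) <= prad p (k - j%:Z).
  move=> jm; have [x [/= hj hm]] := filter_ex (filterI (hc j) (hc m)).
  have {}hm : inball (k - j%:Z) (x - \row_i ratr (c m i)).
    by apply: inball_le hm => //; rewrite lerD2l lerN2 lez_nat.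
  have /(inballP pp)/(_ i) := inballB pp hj hm.
  by rewrite !mxE opprB addrC subrKA ratr_sub_Qp Qp_norm_ratr.
have cauchy i : padic_cauchyb p (c ^~ i).
  apply/asboolP => e e0; have [l hl] := prad_small pp e0.
  (* At this index the radius exponent has come down to at most l. *)
  exists `|k - l|%N => m m' hm hm'.
  have hN : prad p (k - (`|k - l|%N)%:Z) <= prad p l by rewrite prad_le //; lia.
  rewrite -(subrKA (c `|k - l|%N i)) (le_lt_trans _ hl) //.
  rewrite (le_trans (padic_norm_ultra _ _ _)) // ge_max -(padic_normN _ (_ - c m' i)).
  by rewrite opprB !(le_trans (dist _ _ _ _) hN).
pose x : V := \row_i (\pi_(Qp p) (CauchySeq (cauchy i)))%qT.
have hx j : inball (k - j%:Z) (x - \row_i ratr (c j i)).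
  apply/(inballP pp) => i; rewrite !mxE pi_sub_ratr.
  apply: (@Qp_norm_pi_le _ _ _ j) => m jm; exact: dist.
exists x; split => /=.
  rewrite -[x](subrK (\row_i ratr (c 0%N i))) inballD //.
    by have := hx 0%N; rewrite subr0.
  have [y [/= hy yk]] := filter_ex (filterI (hc 0%N) Fk).
  rewrite subr0 in hy; rewrite -[X in inball _ X](subKr y).
  exact: inballB yk hy.
move=> A /nbhs_inball[l hl].
apply: filterS (hc `|k - l|%N) => y /= hy; apply: hl.
have hN : k - (`|k - l|%N)%:Z <= l by lia.
apply: (inball_trans pp (inball_le pp hN (hx _))).
by rewrite inball_distC; exact: inball_le hy.
Qed.

(** The exponent [k] bounds the support and [l] is a uniform scale of constancy. *)
Definition step_fun (T : zmodType) k l (phi : V -> T) :=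
  (forall x, ~~ inball k x -> phi x = 0) /\
  (forall x y, inball l (x - y) -> phi x = phi y).

Lemma step_fun_test (R : realType) k l (phi : V -> R[i]) :
  step_fun k l phi -> test_fun phi.
Proof.
move=> [supp inv]; split=> [x|].
  by apply/nbhs_inball; exists l => y /inv.
apply: (@subclosed_compact V _ [set x | inball k x]).
- exact: closed_closure.
- exact: compact_inball.
rewrite [X in _ `<=` X](closure_id _).1; last exact: closed_inball.
by apply: closureS => x /= /eqP; apply: contra_notT => /supp.
Qed.

(** Compactness of the closed support makes local constancy uniform. Both requirements weaken as [i]
    grows, so a single [N] provides the two exponents. *)
Lemma test_fun_step (R : realType) (phi : V -> R[i]) :
  test_fun phi -> exists k l, step_fun k l phi.
Proof.
move=> [lc /compact_near_coveringP cK].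
pose P (i : nat) x := inball i%:Z x /\ forall y, inball (- i%:Z) (x - y) -> phi y = phi x.
have [|N _ /(_ N (leqnn N)) hN] := cK nat \oo P _.
  move=> x _; have /nbhs_inball[l hl] := lc x; have [k hk] := inball_ex pp x.
  exists ([set y | inball l (x - y)], [set i | (`|k| + `|l| <= i)%N]) => /=.
    split; first by apply/nbhs_inball; exists l.
    by exists (`|k| + `|l|)%N => // i.
  move=> [y i] [/= xy hi]; split=> [|z yz].
    rewrite -[y](subKr x); apply: (inballB pp); [apply: inball_le hk|apply: inball_le xy] => //; lia.
  have yzl : inball l (y - z) by apply: inball_le yz => //; lia.
  by rewrite (hl _ xy) (hl _ (inball_trans pp xy yzl)).
exists N%:Z, (- N%:Z); split=> [x xN|x y xy].
  apply/eqP; apply: contraNT xN => x0.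
  by have [] := hN x (@subset_closure _ [set x | phi x != 0] x x0).
(* Uniform constancy is known only around points of the closed support. If x or y is such a point,
   it applies there; otherwise both values are 0. *)
have [xK|xK] := pselect (closure [set x | phi x != 0] x).
  by have [_ ->] := hN _ xK.
have [yK|yK] := pselect (closure [set x | phi x != 0] y).
  by have [_ ->] := hN _ yK; rewrite // inball_distC.
have supp0 z : ~ closure [set x | phi x != 0] z -> phi z = 0.
  by move=> zK; apply/eqP/negPn/negP => z0; apply/zK/subset_closure.
by rewrite !supp0.
Qed.

End Topology.

(** * Integration of step functions *)

Opaque Qpn_norm.

Section ComplexIntegral.
Context d (T : measurableType d) (R : realType) (mu : {measure set T -> \bar R}).
Implicit Types (f g : T -> R[i]) (c : R[i]).

Definition cintegrable f :=
  mu.-integrable setT (EFin \o (fun x => complex.Re (f x))) /\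
  mu.-integrable setT (EFin \o (fun x => complex.Im (f x))).

Notation cint f := (cintegral mu setT f).

Lemma complex_ReM (z w : R[i]) :
  complex.Re (z * w) = complex.Re z * complex.Re w - complex.Im z * complex.Im w.
Proof. by case: z w => [a b] [u v]. Qed.

Lemma complex_ImM (z w : R[i]) :
  complex.Im (z * w) = complex.Re z * complex.Im w + complex.Im z * complex.Re w.
Proof. by case: z w => [a b] [u v]. Qed.

Lemma complex_ReD (z w : R[i]) : complex.Re (z + w) = complex.Re z + complex.Re w.
Proof. by case: z w => [a b] [u v]. Qed.

Lemma complex_ImD (z w : R[i]) : complex.Im (z + w) = complex.Im z + complex.Im w.
Proof. by case: z w => [a b] [u v]. Qed.

Let intZ (r : R) (u : T -> R) : mu.-integrable setT (EFin \o u) ->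
  mu.-integrable setT (EFin \o (fun x => r * u x)).
Proof.
move=> iu; rewrite (_ : _ \o _ = (fun x => r%:E * (EFin \o u) x)%E).
  exact: integrableZl.
by apply/funext => x.
Qed.

Let intD (u v : T -> R) : mu.-integrable setT (EFin \o u) ->
  mu.-integrable setT (EFin \o v) ->
  mu.-integrable setT (EFin \o (fun x => u x + v x)).
Proof.
move=> iu iv; rewrite (_ : _ \o _ = ((EFin \o u) \+ (EFin \o v))%E).
  exact: integrableD.
by apply/funext => x.
Qed.

Lemma cintegrable0 : cintegrable (fun=> 0).
Proof. by split; exact: integrable0. Qed.

Lemma cint0 : cint (fun=> 0) = 0.
Proof.
have z : \int[mu]_x (0 : R) = 0 by rewrite /Rintegral integral0.
by apply/eqP; rewrite eq_complex /= z eqxx.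
Qed.

Lemma cintegrableZ c f : cintegrable f -> cintegrable (fun x => c * f x).
Proof.
move=> [fr fi]; split.
  rewrite (_ : (fun x => _) = (fun x => complex.Re c * complex.Re (f x) +
     (- complex.Im c) * complex.Im (f x))); last first.
    by apply/funext => x; rewrite complex_ReM mulNr.
  by apply: intD; exact: intZ.
rewrite (_ : (fun x => _) = (fun x => complex.Re c * complex.Im (f x) +
     complex.Im c * complex.Re (f x))); last first.
  by apply/funext => x; rewrite complex_ImM.
by apply: intD; exact: intZ.
Qed.

Lemma cintegrableD f g : cintegrable f -> cintegrable g ->
  cintegrable (fun x => f x + g x).
Proof.
move=> [fr fi] [gr gi]; split.
  rewrite (_ : (fun x => _) = (fun x => complex.Re (f x) + complex.Re (g x))).
    exact: intD.
  by apply/funext => x; rewrite complex_ReD.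
rewrite (_ : (fun x => _) = (fun x => complex.Im (f x) + complex.Im (g x))).
  exact: intD.
by apply/funext => x; rewrite complex_ImD.
Qed.

Lemma cintZ c f : cintegrable f -> cint (fun x => c * f x) = c * cint f.
Proof.
move=> [fr fi]; rewrite {1}/cintegral.
under eq_Rintegral do rewrite complex_ReM -mulNr.
rewrite RintegralD //; [|exact: intZ..].
rewrite !RintegralZl //.
have -> : \int[mu]_x complex.Im (c * f x) =
    complex.Re c * \int[mu]_x complex.Im (f x) +
    complex.Im c * \int[mu]_x complex.Re (f x).
  under eq_Rintegral do rewrite complex_ImM.
  by rewrite RintegralD //; [rewrite !RintegralZl|exact: intZ..].
by apply/eqP; rewrite eq_complex complex_ReM complex_ImM /= mulNr !eqxx.
Qed.

Lemma cintD f g : cintegrable f -> cintegrable g ->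
  cint (fun x => f x + g x) = cint f + cint g.
Proof.
move=> [fr fi] [gr gi]; rewrite {1}/cintegral.
under eq_Rintegral do rewrite complex_ReD.
rewrite RintegralD //.
have -> : \int[mu]_x complex.Im (f x + g x) =
    \int[mu]_x complex.Im (f x) + \int[mu]_x complex.Im (g x).
  under eq_Rintegral do rewrite complex_ImD.
  by rewrite RintegralD.
by apply/eqP; rewrite eq_complex complex_ReD complex_ImD /= !eqxx.
Qed.

Lemma cintegrable_sum (I : Type) (s : seq I) (F : I -> T -> R[i]) :
  (forall i, cintegrable (F i)) -> cintegrable (fun x => \sum_(i <- s) F i x).
Proof.
move=> iF; elim: s => [|i s ih].
  rewrite (_ : (fun x => _) = (fun=> 0)); first exact: cintegrable0.
  by apply/funext => x; rewrite big_nil.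
rewrite (_ : (fun x => _) = (fun x => F i x + \sum_(i <- s) F i x)).
  exact: cintegrableD.
by apply/funext => x; rewrite big_cons.
Qed.

Lemma cint_sum (I : Type) (s : seq I) (F : I -> T -> R[i]) :
  (forall i, cintegrable (F i)) ->
  cint (fun x => \sum_(i <- s) F i x) = \sum_(i <- s) cint (F i).
Proof.
move=> iF; elim: s => [|i s ih].
  rewrite (_ : (fun x => _) = (fun=> 0)); first by rewrite big_nil cint0.
  by apply/funext => x; rewrite big_nil.
rewrite (_ : (fun x => _) = (fun x => F i x + \sum_(i <- s) F i x)).
  by rewrite cintD // ?ih ?big_cons //; exact: cintegrable_sum.
by apply/funext => x; rewrite big_cons.
Qed.

Lemma cintegral_mkcond (D : set T) f :
  cintegral mu D f = cint (fun x => (x \in D)%:R * f x).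
Proof.
rewrite /cintegral !(Rintegral_mkcond mu D).
congr (_ +i* _); apply: eq_Rintegral => x _; rewrite patchE.
  by case: ifP => _; rewrite ?mul1r ?mul0r.
by case: ifP => _; rewrite ?mul1r ?mul0r.
Qed.

Lemma cintegrable_real (u : T -> R) :
  mu.-integrable setT (EFin \o u) -> cintegrable (fun x => (u x)%:C).
Proof. by move=> iu; split=> //=; exact: integrable0. Qed.

Lemma cint_real (u : T -> R) : cint (fun x => (u x)%:C) = (\int[mu]_x u x)%:C.
Proof.
rewrite /cintegral /=; congr (_ +i* _).
by rewrite /Rintegral (_ : (fun x => _) = cst 0%E) // integral0.
Qed.

Lemma integrable_indic_lt_pinfty (A : set T) : measurable A ->
  (mu A < +oo)%E -> mu.-integrable setT (EFin \o \1_A).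
Proof.
move=> mA Aoo; apply/integrableP; split; first exact/measurable_EFinP.
rewrite (eq_integral (fun x => (\1_A x)%:E)) => [|x _].
  by rewrite integral_indic // setIT.
by rewrite gee0_abs // lee_fin.
Qed.

End ComplexIntegral.

Section Haar.
Variables (R : realType) (p n : nat) (mu : {measure set (borel_Qpn p n) -> \bar R}).
Hypothesis pp : prime p.
Hypothesis hmu : normalized_haar mu.
Notation V := 'rV[Qp p]_n.
Implicit Types (x y a b : V) (k l : int) (t : Qp p) (f g : V -> R[i]) (c : R[i]).
Notation cint f := (cintegral mu setT f).

Definition haar_vol k : R := (p%:R ^+ n) ^ k.
Notation vol := haar_vol.

Lemma pn_gt0 : 0 < p%:R ^+ n :> R.
Proof. by rewrite exprn_gt0 // ltr0n prime_gt0. Qed.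

Lemma volD k l : vol (k + l) = vol k * vol l.
Proof. by rewrite /haar_vol expfzDr // gt_eqF // pn_gt0. Qed.

Lemma vol_gt0 k : 0 < vol k.
Proof. by rewrite exprz_gt0 // pn_gt0. Qed.

Lemma measurable_inball k a :
  measurable ([set x | inball k (x - a)] : set (borel_Qpn p n)).
Proof. apply: sub_sigma_algebra; exact: open_inball. Qed.

Lemma mu_inball_center k a :
  mu [set x | inball k (x - a)] = mu [set x | inball k (x - 0)].
Proof.
transitivity (mu [set (a + x : V) | x in [set x | inball k (x - 0)]]); last first.
  exact: hmu.1 _ a (measurable_inball k 0).
congr (mu _).
apply/seteqP; split=> [x /= xa|_ [x /= xk <-]].
  by exists (x - a); rewrite ?subr0 // addrC subrK.
by rewrite addrAC subrr add0r -[x]subr0.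
Qed.

(** The ball is the disjoint union of p^(jn) cosets of the smaller one, all of the same measure by
    translation. *)
Lemma mu_inball_coset k (j : nat) :
  mu [set x | inball k (x - 0)] =
  (mu [set x | inball (k - j%:Z) (x - 0)] *+ ((p ^ j) ^ n))%E.
Proof.
rewrite [X in mu X = _](_ : _ = \bigcup_(c in [set` enum {: 'rV['I_(p ^ j)]_n}])
    [set x | inball (k - j%:Z) (x - coset_rep k c)]); last first.
  apply/seteqP; split=> [x|x [c _] /=]; rewrite /= subr0.
    by move=> /(inball_coset_rep pp j)[c hc _]; exists c; rewrite //= mem_enum.
  move=> xc; rewrite -[x](subrK (coset_rep k c)); apply: (inballD pp).
    by apply: inball_le xc => //; rewrite gerBl.
  exact: inball_coset_repk.
rewrite measure_fin_bigcup; last 3 first.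
- exact: finite_seq.
- move=> c c' _ _ [x [/= xc xc']].
  have xk : inball k x.
    rewrite -[x](subrK (coset_rep k c)); apply: (inballD pp).
      by apply: inball_le xc => //; rewrite gerBl.
    exact: inball_coset_repk.
  by have [c0 _ hc0] := inball_coset_rep pp j xk; rewrite (hc0 _ xc) (hc0 _ xc').
- move=> c _; exact: measurable_inball.
rewrite -fsbig_seq ?enum_uniq // big_enum /=.
transitivity (\sum_(c in {: 'rV['I_(p ^ j)]_n})
    mu [set x | inball (k - j%:Z) (x - 0)])%E.
  by apply: eq_bigr => c _; exact: mu_inball_center.
by rewrite sumr_const card_mx card_ord mul1n.
Qed.

Lemma mu_inball k a : mu [set x | inball k (x - a)] = (vol k)%:E.
Proof.
rewrite mu_inball_center.
have mu1 : mu [set x | inball 0 (x - 0)] = 1%E.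
  rewrite -hmu.2; congr (mu _); apply/seteqP.
  by split=> x /=; rewrite subr0.
have natE (j : nat) : ((p ^ j) ^ n)%:R = vol j :> R.
  by rewrite !natrX; exact: exprAC.
case: k => j.
  by rewrite (mu_inball_coset _ j) subrr mu1 -[1%E]/(1%:E) -EFin_natmul natE.
(* For a negative exponent the unit ball is subdivided instead. An infinite measure is impossible,
   since a positive multiple of it would have to equal 1. *)
have := mu_inball_coset 0 j.+1; rewrite mu1 sub0r NegzE.
have N0 : (0 < (p ^ j.+1) ^ n)%N by rewrite !expn_gt0 prime_gt0.
move: ((p ^ j.+1) ^ n)%N N0 (natE j.+1) => [//|N] _ NE.
case: (mu _) => [r| |]; last 2 first.
- by rewrite enatmul_pinfty.
- by rewrite enatmul_ninfty.
rewrite -EFin_natmul => -[] h; congr EFin; rewrite -mulr_natr NE in h.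
apply: (mulIf (lt0r_neq0 (vol_gt0 j.+1))); rewrite -volD addNr.
by rewrite -h /haar_vol expr0z.
Qed.

Definition ind k a : V -> R[i] := fun x => (inball k (x - a))%:R.

Lemma indE k a : ind k a = (fun x => (\1_[set x | inball k (x - a)] x : R)%:C).
Proof.
apply/funext => x; rewrite /ind indicE; case: (boolP (inball k (x - a))) => h.
  by rewrite mem_set.
by rewrite memNset //; exact/negP.
Qed.

Lemma cintegrable_ind k a : cintegrable mu (ind k a).
Proof.
rewrite indE; apply/cintegrable_real/integrable_indic_lt_pinfty.
  exact: measurable_inball.
by rewrite mu_inball ltry.
Qed.

Lemma cint_ind k a : cint (ind k a) = (vol k)%:C.
Proof.
rewrite indE cint_real; congr (_%:C); rewrite /Rintegral integral_indic //.
  by rewrite setIT mu_inball.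
exact: measurable_inball.
Qed.

Lemma step_fun_le k l k' l' f : k <= k' -> l' <= l ->
  step_fun k l f -> step_fun k' l' f.
Proof.
move=> kk ll [supp inv]; split=> [x xk|x y xy].
  by apply: supp; apply: contra xk; exact: inball_le.
by apply: inv; exact: inball_le xy.
Qed.

(** At a point of the large ball exactly one coset contributes; elsewhere none does. *)
Lemma step_fun_decomp k (j : nat) f : step_fun k (k - j%:Z) f ->
  f = fun x => \sum_(c : 'rV['I_(p ^ j)]_n)
                 f (coset_rep k c) * ind (k - j%:Z) (coset_rep k c) x.
Proof.
move=> [supp inv]; apply/funext => x.
have [xk|xk] := boolP (inball k x).
  have [c0 hc0 uc0] := inball_coset_rep pp j xk.
  rewrite (bigD1 c0) //= big1 => [|c cc0].
    by rewrite addr0 /ind hc0 mulr1; exact: inv.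
  rewrite /ind; case: (boolP (inball _ _)); rewrite ?mulr0 // => /uc0 h.
  by rewrite h eqxx in cc0.
rewrite supp // big1 // => c _; rewrite /ind.
case: (boolP (inball _ _)); rewrite ?mulr0 // => xc.
case/negP: xk; rewrite -[x](subrK (coset_rep k c)); apply: (inballD pp).
  by apply: inball_le xc => //; rewrite gerBl.
exact: inball_coset_repk.
Qed.

Definition stepf f := exists k l, step_fun k l f.

Lemma stepfP f : stepf f -> exists k (j : nat), step_fun k (k - j%:Z) f.
Proof.
move=> [k [l h]]; exists k, `|k - l|%N; apply: step_fun_le h => //; lia.
Qed.

Lemma stepf_cintegrable f : stepf f -> cintegrable mu f.
Proof.
move=> /stepfP[k [j /step_fun_decomp ->]].
by apply: cintegrable_sum => c; apply: cintegrableZ; exact: cintegrable_ind.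
Qed.

(** By linearity it is enough to treat indicators of balls, and all balls of one radius have the
    same volume. *)
Lemma cint_translate f b : stepf f -> cint (fun x => f (x + b)) = cint f.
Proof.
move=> /stepfP[k [j /step_fun_decomp fE]].
rewrite fE [LHS]cint_sum; last first.
  move=> c; apply: cintegrableZ.
  rewrite (_ : (fun x => _) = ind (k - j%:Z) (coset_rep k c - b)).
    exact: cintegrable_ind.
  by apply/funext => x; rewrite /ind opprB addrA.
rewrite cint_sum => [|c]; last exact/cintegrableZ/cintegrable_ind.
apply: eq_bigr => c _.
have indZ a d : cint (fun x => d * ind (k - j%:Z) a x) = d * (vol (k - j%:Z))%:C.
  by rewrite -(cint_ind _ a); apply: cintZ; exact: cintegrable_ind.
apply: eq_trans (eq_trans (indZ (coset_rep k c - b) _) (esym (indZ _ _))).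
apply: (congr1 (fun h : V -> R[i] => cint h)).
by apply/funext => x; rewrite /ind opprB addrA.
Qed.

End Haar.

Opaque Qp_char cexp.

(** * Radial weights and cut-off characters *)

Section Pairing.
Variables (R : realType) (p n : nat) (mu : {measure set (borel_Qpn p n) -> \bar R}).
Hypothesis pp : prime p.
Hypothesis hmu : normalized_haar mu.
Notation V := 'rV[Qp p]_n.
Notation chi := (Qp_char R).
Implicit Types (x y a b : V) (k l m K M N : int) (t : Qp p) (f g : V -> R[i]) (c : R[i]).
Notation cint f := (cintegral mu setT f).
Notation vol := (haar_vol R p n).

Lemma norm_shell k x : inball (k + 1) x -> ~~ inball k x -> Qpn_norm x = prad p (k + 1).
Proof.
have [->|/(Qpn_norm_val pp)[j hj]] := eqVneq x 0; first by rewrite !inball0.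
rewrite !(inball_prad pp _ hj) hj => h1 h2; congr (prad _ _); lia.
Qed.

(** The norm is constant on a ball that misses 0, because x and y lie in the same balls of radius at
    least p^m around 0. *)
Lemma norm_far m x y : ~~ inball m x -> inball m (x - y) -> Qpn_norm x = Qpn_norm y.
Proof.
move=> xm xy.
have e j : m <= j -> inball j x = inball j y.
  move=> mj; rewrite {1}(_ : x = y + (x - y)); last by rewrite addrC subrK.
  exact: inballDr (inball_le pp mj xy).
have ym : ~~ inball m y by rewrite -e.
have x0 : x != 0 by apply: contraNneq xm => ->; exact: inball0.
have y0 : y != 0 by apply: contraNneq ym => ->; exact: inball0.
have [j hj] := Qpn_norm_val pp x0; have [j' hj'] := Qpn_norm_val pp y0.
move: xm ym; rewrite !(inball_prad pp _ hj) !(inball_prad pp _ hj') => xm ym.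
have := e j; have := e j'.
rewrite !(inball_prad pp _ hj) !(inball_prad pp _ hj') hj hj' => h1 h2.
congr (prad _ _); lia.
Qed.

(** Constancy at one scale over the whole space, without a condition on the support: such functions
    multiply step functions into step functions. *)
Definition loc_cst (h : V -> R[i]) :=
  exists l, forall x y, inball l (x - y) -> h x = h y.

Lemma loc_cst_cst c : loc_cst (fun=> c).
Proof. by exists 0. Qed.

Lemma loc_cst_ball (F : bool -> R[i]) k a : loc_cst (fun x => F (inball k (x - a))).
Proof.
exists k => x y xy; congr F; rewrite -(inballDr pp (x - a) (y := y - x)).
  by rewrite addrC addrA subrK.
by rewrite inball_distC.
Qed.

Lemma loc_cst_ball0 (F : bool -> R[i]) k : loc_cst (fun x => F (inball k x)).
Proof.
have [l hl] := loc_cst_ball F k 0; exists l => x y /hl.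
by rewrite !subr0.
Qed.

Lemma loc_cst_char a : loc_cst (chi a).
Proof.
have [l hl] := inball_ex pp a; exists (- l) => x y xy.
rewrite -[x](subrK y) QcharD // (Qchar_inball _ pp _ xy) ?mul1r //.
by rewrite opprK.
Qed.

Lemma stepf_ind k a : stepf (ind R k a : V -> R[i]).
Proof.
have [l hl] := loc_cst_ball (fun b : bool => b%:R) k a.
have [k' hk'] := inball_ex pp a.
exists (Num.max k k'), l; split=> [x xk|]; last exact: hl.
rewrite /ind; case: (boolP (inball k (x - a))) => // xa; case/negP: xk.
rewrite -[x](subrK a) inballD //.
  by apply: inball_le xa; rewrite // le_max lexx.
by apply: inball_le hk'; rewrite // le_max lexx orbT.
Qed.

Lemma stepfL c f g : stepf f -> stepf g -> stepf (fun x => c * f x + g x).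
Proof.
move=> [k [l h]] [k' [l' h']]; pose k0 := Num.max k k'; pose l0 := Num.min l l'.
have [s i] : step_fun k0 l0 f.
  by apply: step_fun_le h; rewrite // ?le_max ?ge_min lexx.
have [s' i'] : step_fun k0 l0 g.
  by apply: step_fun_le h'; rewrite // ?le_max ?ge_min lexx ?orbT.
exists k0, l0; split=> [x xk|x y xy]; first by rewrite s // s' // mulr0 addr0.
by rewrite (i _ _ xy) (i' _ _ xy).
Qed.

Lemma stepf_mull (h : V -> R[i]) f : loc_cst h -> stepf f -> stepf (fun x => h x * f x).
Proof.
move=> [l' hl] [k [l hf]]; exists k, (Num.min l l').
have [s i] : step_fun k (Num.min l l') f.
  by apply: step_fun_le hf; rewrite // ?ge_min lexx.
split=> [x xk|x y xy]; first by rewrite s // mulr0.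
rewrite (i _ _ xy) (hl x y) //; apply: inball_le xy => //.
by rewrite ge_min lexx orbT.
Qed.

Lemma stepf_ballM (F : bool -> R[i]) k f :
  stepf f -> stepf (fun x => F (inball k x) * f x).
Proof. exact/stepf_mull/loc_cst_ball0. Qed.

Lemma stepfZ c f : stepf f -> stepf (fun x => c * f x).
Proof. exact/stepf_mull/loc_cst_cst. Qed.

Lemma stepfD f g : stepf f -> stepf g -> stepf (fun x => f x + g x).
Proof.
by move=> hf hg; have := stepfL 1 hf hg; under eq_fun do rewrite mul1r.
Qed.

(** The singularity of a kernel at 0 is harmless once f vanishes on a ball around 0: off that ball
    the norm, and so w, is constant at scale p^m. *)
Lemma stepf_weight (w f : V -> R[i]) m :
  (forall x y, Qpn_norm x = Qpn_norm y -> w x = w y) ->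
  (forall x, inball m x -> f x = 0) -> stepf f -> stepf (fun x => w x * f x).
Proof.
move=> hw f0 [k [l hf]]; exists k, (Num.min l m).
have [s i] : step_fun k (Num.min l m) f.
  by apply: step_fun_le hf; rewrite // ?ge_min lexx.
split=> [x xk|x y xy]; first by rewrite s // mulr0.
have xym : inball m (x - y).
  by apply: inball_le xy => //; rewrite ge_min lexx orbT.
have [xm|xm] := boolP (inball m x); last by rewrite (hw _ _ (norm_far xm xym)) (i _ _ xy).
have ym : inball m y by rewrite -[y](subKr x); apply: inballB.
by rewrite !f0 // !mulr0.
Qed.

Lemma stepf_near0 f : stepf f -> exists m, forall x, inball m x -> f x = f 0.
Proof. by move=> [k [l [_ h]]]; exists l => x xl; apply: h; rewrite subr0. Qed.

Lemma stepf_translate f b : stepf f -> stepf (fun x => f (x + b)).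
Proof.
move=> [k [l [s i]]]; have [k' hk'] := inball_ex pp b.
exists (Num.max k k'), l; split=> [x xk|x y xy].
  apply: s; apply: contra xk => xb; rewrite -[x](addrK b) inballB //.
    by apply: inball_le xb; rewrite // le_max lexx.
  by apply: inball_le hk'; rewrite // le_max lexx orbT.
by apply: i; rewrite opprD addrACA subrr addr0.
Qed.

Lemma stepf_opp f : stepf f -> stepf (fun x => f (- x)).
Proof.
move=> [k [l [s i]]]; exists k, l; split=> [x xk|x y xy].
  by apply: s; rewrite inballN.
by apply: i; rewrite -opprD inballN.
Qed.

(** This is e(a,N), up to a scalar the Fourier transform of the indicator of the ball of radius
    p^(-N) about [a]. *)
Definition wave N a : V -> R[i] := fun x => (inball N x)%:R * chi a x.

Lemma stepf_wave N a : stepf (wave N a).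
Proof.
have -> : wave N a = (fun x => chi a x * ind R N 0 x).
  by apply/funext => x; rewrite /ind subr0 mulrC.
exact/stepf_mull/stepf_ind/loc_cst_char.
Qed.

Lemma wave_near0 N a m x : m <= N -> inball (- m) a -> inball m x -> wave N a x = 1.
Proof.
move=> mN am xm; rewrite /wave (Qchar_inball _ pp am xm) mulr1.
by rewrite (inball_le pp mN xm).
Qed.

(* Translation by some b with chi(b) <> 1 multiplies the integral by chi(b). *)
Lemma cint_wave k a : cint (wave k a) = if inball (- k) a then (vol k)%:C else 0.
Proof.
case: (boolP (inball (- k) a)) => [ak|/(Qchar_nontrivial R pp)[b bk b1]].
  rewrite -(cint_ind pp hmu k 0); congr (cintegral _ _ _); apply/funext => x.
  rewrite /wave /ind subr0; case: (boolP (inball k x)) => xk; rewrite ?mul0r //.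
  by rewrite (Qchar_inball _ pp ak xk) mulr1.
have h : cint (wave k a) = chi a b * cint (wave k a).
  rewrite -[LHS](cint_translate pp hmu b) ; last exact: stepf_wave.
  rewrite -cintZ; last exact/(stepf_cintegrable pp hmu)/stepf_wave.
  apply: (congr1 (fun h : V -> R[i] => cint h)); apply/funext => x.
  by rewrite /wave (inballDr pp x bk) (QcharD R pp a x b) mulrA mulrC.
apply/eqP; move/eqP: h; rewrite -subr_eq0 -{1}[cint _]mul1r -mulrBl mulf_eq0.
by rewrite subr_eq0 eq_sym (negPf b1).
Qed.

Lemma ball_waveE k N a x :
  (inball k x)%:R * wave N a x = wave (Num.min k N) a x.
Proof.
rewrite /wave mulrA -natrM mulnb; congr (_%:R * _); congr nat_of_bool.
case: (leP k N) => kN; apply/idP/idP => [/andP[]//|h]; apply/andP; split=> //.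
  exact: inball_le h.
by apply: inball_le h => //; exact: ltW.
Qed.

(** When |a| > p^(-N) the integral has already dropped to 0 at radius p^N, so the cut-off does not
    change the value found for the bare character. *)
Lemma cint_ball_wave k N a : ~~ inball (- N) a ->
  cint (fun x => (inball k x)%:R * wave N a x) =
  if inball (- k) a then (vol k)%:C else 0.
Proof.
move=> aN; rewrite (_ : (fun x => _) = wave (Num.min k N) a); last first.
  by apply/funext => x; rewrite ball_waveE.
rewrite cint_wave; case: (leP k N) => // kN; rewrite (negPf aN).
case: ifP => // ak; case/negP: aN; apply: inball_le ak => //.
by rewrite lerN2 ltW.
Qed.

Definition shell K M x := inball K x && ~~ inball M x.

(* P is a discrete primitive of q dB, where B k is the integral of G over the
   ball of radius p^k and q k the value of w on the sphere of that radius. *)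
Lemma shell_sum (q P B : int -> R[i]) (w G : V -> R[i]) M :
  (forall x k, Qpn_norm x = prad p k -> w x = q k) ->
  (forall k, stepf (fun x => (inball k x)%:R * G x)) ->
  (forall k, cint (fun x => (inball k x)%:R * G x) = B k) ->
  (forall k, M <= k -> P (k + 1) - P k = q (k + 1) * (B (k + 1) - B k)) ->
  forall K, M <= K ->
    stepf (fun x => (shell K M x)%:R * (w x * G x)) /\
    cint (fun x => (shell K M x)%:R * (w x * G x)) = P K - P M.
Proof.
move=> hw sG IG hP K MK; rewrite -(subrK M K).
have -> : K - M = (`|K - M|%N)%:Z by lia.
elim: `|K - M|%N => [|j [ihs ihi]].
  rewrite add0r subrr.
  rewrite (_ : (fun x => _) = (fun=> 0)); last first.
    by apply/funext => x; rewrite /shell andbN mul0r.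
  by split; [exists 0, 0; split | exact: cint0].
set L := j%:Z + M in ihs ihi *; have -> : j.+1%:Z + M = L + 1 by rewrite /L; lia.
pose D x := (inball (L + 1) x)%:R * G x + (-1) * ((inball L x)%:R * G x).
have sD : stepf D by apply: stepfD => //; exact: stepfZ.
have -> : (fun x => (shell (L + 1) M x)%:R * (w x * G x)) =
    (fun x => q (L + 1) * D x + (shell L M x)%:R * (w x * G x)).
  apply/funext => x; rewrite /shell /D.
  have LM : M <= L by rewrite /L; lia.
  have L1 : L <= L + 1 by lia.
  have [xL|xL] := boolP (inball L x).
    by rewrite (inball_le pp L1 xL); ring.
  have xM : ~~ inball M x by apply: contra xL; exact: inball_le.
  have [xL1|xL1] := boolP (inball (L + 1) x); last by rewrite !mul0r; ring.
  by rewrite xM (hw _ _ (norm_shell xL1 xL)) /=; ring.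
split; first exact: stepfL.
have IS f : stepf f -> cintegrable mu f by exact: stepf_cintegrable.
rewrite cintD; [|by apply/IS/stepfZ|exact: IS].
rewrite cintZ; last exact: IS.
rewrite ihi cintD; [|exact: IS|by apply/IS/stepfZ].
rewrite cintZ; last exact: IS.
rewrite !IG mulN1r -hP; last by rewrite /L; lia.
by ring.
Qed.

End Pairing.

(** * The Riesz kernel *)

Section RealPowers.
Variables (R : realType) (p n : nat).
Hypothesis pp : prime p.
Notation V := 'rV[Qp p]_n.
Implicit Types (x : V) (k l j : int) (a b : R[i]).
Notation vol := (haar_vol R p n).

Lemma ln_exprz (r : R) k : 0 < r -> ln (r ^ k) = k%:~R * ln r.
Proof.
move=> r0; case: k => k; first by rewrite -exprnP lnXn // mulr_natl.
by rewrite NegzE -exprnN lnV ?posrE ?exprn_gt0 // lnXn // mulrNz mulNr mulr_natl.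
Qed.

Lemma ratr_prad k : ratr (prad p k) = p%:R ^ k :> R.
Proof. by rewrite /prad fmorphXz /= ratr_nat. Qed.

Lemma natr_p_gt0 : 0 < p%:R :> R.
Proof. by rewrite ltr0n prime_gt0. Qed.

Lemma ln_p_gt0 : 0 < ln p%:R :> R.
Proof. by rewrite ln_gt0 // ltr1n prime_gt1. Qed.

Definition ppow k a : R[i] := cexp (a * (k%:~R * ln p%:R)%:C).
Notation cp := ppow.

Lemma cpow_prad k a : cpow (ratr (prad p k)) a = cp k a.
Proof. by rewrite /cpow ratr_prad ln_exprz // natr_p_gt0. Qed.

Lemma cpow_norm x k a : Qpn_norm x = prad p k -> cpow (Qpn_abs R x) a = cp k a.
Proof. by move=> xk; rewrite /Qpn_abs xk cpow_prad. Qed.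

Lemma cpow_p a : cpow p%:R a = cp 1 a.
Proof. by rewrite /cpow /ppow mul1r. Qed.

Lemma ppow_neq0 k a : cp k a != 0. Proof. exact: cexp_neq0. Qed.

Lemma ppowD k l a : cp (k + l) a = cp k a * cp l a.
Proof. by rewrite /ppow -cexpD intrD mulrDl rmorphD mulrDr. Qed.

Lemma ppowA k a b : cp k (a + b) = cp k a * cp k b.
Proof. by rewrite /ppow mulrDl cexpD. Qed.

Lemma ppow0 k : cp k 0 = 1.
Proof. by rewrite /ppow mul0r cexp0. Qed.

Lemma ppowN k a : cp k (- a) = (cp k a)^-1.
Proof.
by apply: (mulIf (ppow_neq0 k a)); rewrite -ppowA addNr ppow0 mulVf // ppow_neq0.
Qed.

Lemma ppowNl k a : cp (- k) a = cp k (- a).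
Proof. by rewrite /ppow mulrNz mulNr rmorphN mulrN mulNr. Qed.

Lemma cexp_real (r : R) : cexp r%:C = (expR r)%:C.
Proof.
Transparent cexp.
by rewrite /cexp /= cos0 sin0; simpc.
Qed.
Opaque cexp.

Lemma vol_expR k : vol k = expR (n%:R * (k%:~R * ln p%:R)).
Proof.
rewrite -[LHS]lnK ?posrE ?vol_gt0 //; congr expR.
rewrite /haar_vol ln_exprz; last by rewrite exprn_gt0 // natr_p_gt0.
by rewrite lnXn ?natr_p_gt0 // -[_ *+ n]mulr_natl mulrCA.
Qed.

Lemma ppow_nat k : cp k n%:R = (vol k)%:C.
Proof.
have e : (n%:R : R[i]) = (n%:R : R)%:C by rewrite rmorph_nat.
by rewrite vol_expR -cexp_real /ppow e -rmorphM.
Qed.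

(** The periods of a |-> p^a are the points mu_j, so the exceptional orders of the Riesz kernel are
    exactly those where the numerator or the denominator of Gamma vanishes. *)
Lemma ppow_eq1 a : cp 1 a = 1 -> exists j, a = riesz_pole R p j.
Proof.
rewrite /ppow mul1r => /cexp_eq1[j]; have l0 := lt0r_neq0 ln_p_gt0.
case: a => u v; simpc => -[hu hv]; exists j; rewrite /riesz_pole.
congr (_ +i* _); first by apply/eqP; move/eqP: hu; rewrite mulf_eq0 (negPf l0) orbF.
by apply: (mulIf l0); rewrite hv; field.
Qed.

Lemma ppow_pole k j : cp k (riesz_pole R p j) = 1.
Proof.
have l0 := lt0r_neq0 ln_p_gt0.
rewrite /ppow /riesz_pole -(@ce_int R (j * k)%:~R) ?intr_int // /ce.
by congr cexp; simpc; rewrite intrM; congr (_ +i* _); field.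
Qed.

End RealPowers.

(** * The pairing with the regularized power of the norm *)

Section Generic.
Variables (R : realType) (p n : nat) (mu : {measure set (borel_Qpn p n) -> \bar R}).
Hypothesis pp : prime p.
Hypothesis hmu : normalized_haar mu.
Notation V := 'rV[Qp p]_n.
Notation chi := (Qp_char R).
Implicit Types (x y b : V) (k l m K M N : int) (f g phi : V -> R[i]) (a c : R[i]).
Notation cint f := (cintegral mu setT f).
Notation vol := (haar_vol R p n).
Notation cp := (@ppow R p).

Definition radial (w : V -> R[i]) := forall x y, Qpn_norm x = Qpn_norm y -> w x = w y.

Definition inner_part (w : V -> R[i]) phi : V -> R[i] :=
  fun x => (inball 0 x)%:R * (w x * (phi x - phi 0)).

Definition outer_part (w : V -> R[i]) phi : V -> R[i] :=
  fun x => (~~ inball 0 x)%:R * (w x * phi x).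

Definition riesz_weight a : V -> R[i] := fun x => cpow (Qpn_abs R x) (a - n%:R).

Lemma radial_riesz_weight a : radial (riesz_weight a).
Proof. by move=> x y xy; rewrite /riesz_weight /Qpn_abs xy. Qed.

Lemma mem_unit_ball x : (x \in @unit_ball p n) = inball 0 x.
Proof. by apply/idP/idP => [/set_mem|h]; [|apply/mem_set]. Qed.

Lemma abs_pow_pairingE a phi :
  abs_pow_pairing mu a phi =
  cint (inner_part (riesz_weight a) phi) + cint (outer_part (riesz_weight a) phi) +
  phi 0 * ((1 - cp 1 (- n%:R)) / (1 - cp 1 (- a))).
Proof.
rewrite /abs_pow_pairing !cpow_p; congr (_ + _ + _).
  rewrite cintegral_mkcond; apply: (congr1 (fun h : V -> R[i] => cint h)).
  by apply/funext => x; rewrite mem_unit_ball.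
rewrite cintegral_mkcond; apply: (congr1 (fun h : V -> R[i] => cint h)).
by apply/funext => x; rewrite in_setC mem_unit_ball.
Qed.

(** Subtracting phi(0) makes the factor beside the weight vanish near 0; in the outer part the unit
    ball is cut away instead. *)
Lemma stepf_inner w phi : radial w -> stepf phi -> stepf (inner_part w phi).
Proof.
move=> hw sp; rewrite (_ : inner_part w phi =
  (fun x => w x * ((inball 0 x)%:R * phi x + (- phi 0) * ind R 0 0 x))).
  have [m hm] := stepf_near0 sp; apply: (@stepf_weight _ _ _ pp _ _ (Num.min m 0)) => //.
    move=> x xm; have x0 : inball 0 x by apply: inball_le xm; rewrite // ge_min lexx orbT.
    have xm' : inball m x by apply: inball_le xm; rewrite // ge_min lexx.
    by rewrite /ind subr0 x0 (hm _ xm') mul1r mulr1 subrr.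
  apply: stepfD => //.
    exact: (stepf_ballM pp (fun b : bool => b%:R : R[i]) 0 sp).
  by apply: stepfZ => //; exact: stepf_ind.
by apply/funext => x; rewrite /ind subr0 /inner_part; ring.
Qed.

Lemma stepf_outer w phi : radial w -> stepf phi -> stepf (outer_part w phi).
Proof.
move=> hw sp; rewrite (_ : outer_part w phi =
    (fun x => w x * ((~~ inball 0 x)%:R * phi x))).
  apply: (@stepf_weight _ _ _ pp _ _ 0) => //; first by move=> x ->; rewrite mul0r.
  exact: (stepf_ballM pp (fun b : bool => (~~ b)%:R : R[i]) 0 sp).
by apply/funext => x; rewrite /outer_part mulrCA.
Qed.

Lemma abs_pow_pairingL a c f g : stepf f -> stepf g ->
  abs_pow_pairing mu a (fun x => c * f x + g x) =
  c * abs_pow_pairing mu a f + abs_pow_pairing mu a g.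
Proof.
move=> sf sg; rewrite !abs_pow_pairingE; set w := riesz_weight a.
have rw : radial w := radial_riesz_weight a.
have IS h : stepf h -> cintegrable mu h by exact: stepf_cintegrable.
have -> : inner_part w (fun x => c * f x + g x) =
    (fun x => c * inner_part w f x + inner_part w g x).
  by apply/funext => x; rewrite /inner_part; ring.
have -> : outer_part w (fun x => c * f x + g x) =
    (fun x => c * outer_part w f x + outer_part w g x).
  by apply/funext => x; rewrite /outer_part; ring.
have i1 := IS _ (stepf_inner rw sf); have i2 := IS _ (stepf_inner rw sg).
have o1 := IS _ (stepf_outer rw sf); have o2 := IS _ (stepf_outer rw sg).
rewrite !cintD //; try exact: cintegrableZ.
by rewrite !cintZ //; ring.
Qed.

(* A is a primitive of the sphere integrals of |x|^(a-n), and P of those of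
   |x|^(a-n) chi(b.x): the latter vanish beyond the radius p^(m+1), where
   |b| = p^-m.  The regularizing term of the pairing is A 0. *)
Lemma abs_pow_pairing_wave a N b m :
  cp 1 a != 1 -> Qpn_norm b = prad p (- m) -> m < N ->
  abs_pow_pairing mu a (wave R N b) =
  padic_Gamma p n a * cp m a.
Proof.
move=> a1 bm mN; set T := (1 - cp 1 (- n%:R)) / (1 - cp 1 (- a)).
pose q k := cp k (a - n%:R).
pose A k := T * cp k a.
pose B k : R[i] := if k <= m then (vol k)%:C else 0.
pose P k := if k <= m then A k else A m - q (m + 1) * (vol m)%:C.
have bk k : inball (- k) b = (k <= m) by rewrite (inball_prad pp _ bm) lerN2.
have bN : ~~ inball (- N) b by rewrite bk -ltNge.
have hw x k : Qpn_norm x = prad p k -> riesz_weight a x = q k.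
  by move=> xk; rewrite /riesz_weight (cpow_norm pp _ xk).
have hA k : A (k + 1) - A k = q (k + 1) * ((vol (k + 1))%:C - (vol k)%:C).
  rewrite /A /q /T -!(ppow_nat R n pp) !ppowA !ppowD !ppowN.
  have v0 := ppow_neq0 p 1 (n%:R : R[i]); have vk0 := ppow_neq0 p k (n%:R : R[i]).
  have c1 := ppow_neq0 p 1 a; have ck := ppow_neq0 p k a.
  by field; rewrite v0 vk0 c1 subr_eq0 a1.
have hP k : P (k + 1) - P k = q (k + 1) * (B (k + 1) - B k).
  rewrite /P /B; case: (leP (k + 1) m) => k1.
    by have -> : k <= m by lia.
  case: (leP k m) => km; last by rewrite subrr subrr mulr0.
  have -> : k = m by lia.
  by ring.
have Bw k : cint (fun x => (inball k x)%:R * wave R N b x) = B k.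
  by rewrite cint_ball_wave // bk.
have sw k : stepf (fun x => (inball k x)%:R * wave R N b x).
  exact: (stepf_ballM pp (fun b : bool => b%:R : R[i]) k (stepf_wave R pp N b)).
have IS h : stepf h -> cintegrable mu h by exact: stepf_cintegrable.
have w0 : wave R N b 0 = 1.
  by rewrite /wave inball0 // Qchar0 // mul1r.
have near0 M x : M <= m -> inball M x -> wave R N b x = 1.
  move=> Mm; apply: wave_near0 => //; last by rewrite bk.
  exact: le_trans Mm (ltW mN).
pose G x := wave R N b x - 1.
have GE k : (fun x => (inball k x)%:R * G x) =
    (fun x => (inball k x)%:R * wave R N b x + (-1) * ind R k 0 x).
  by apply/funext => x; rewrite /ind subr0 /G; ring.
have sG k : stepf (fun x => (inball k x)%:R * G x).
  by rewrite GE; apply: stepfD => //; apply: stepfZ => //; exact: stepf_ind.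
have IG k : cint (fun x => (inball k x)%:R * G x) = B k - (vol k)%:C.
  rewrite GE cintD; [|exact: IS|by apply/IS/stepfZ => //; exact: stepf_ind].
  rewrite cintZ; last exact/IS/stepf_ind.
  by rewrite Bw cint_ind // mulN1r.
pose M := Num.min m 0; have Mm : M <= m by rewrite ge_min lexx.
have M0 : M <= 0 by rewrite ge_min lexx orbT.
(* Here wave - 1 takes the place of the wave, with primitive P - A. Since P = A at exponents up to
   m, the lower end M contributes nothing. *)
have inner : cint (inner_part (riesz_weight a) (wave R N b)) = P 0 - A 0.
  rewrite (_ : inner_part _ _ = (fun x => (shell 0 M x)%:R * (riesz_weight a x * G x))).
    have hPA k : M <= k -> (P (k + 1) - A (k + 1)) - (P k - A k) =
        q (k + 1) * ((B (k + 1) - (vol (k + 1))%:C) - (B k - (vol k)%:C)).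
      move=> _; transitivity ((P (k + 1) - P k) - (A (k + 1) - A k)); first by ring.
      by rewrite hP hA; ring.
    have [_ ->] := shell_sum pp hmu hw sG IG hPA M0.
    have -> : P M = A M by rewrite /P Mm.
    by rewrite subrr subr0.
  apply/funext => x; rewrite /inner_part /shell w0 -/(G x).
  have [xM|xM] := boolP (inball M x); last by rewrite andbT.
  by rewrite /G (near0 _ _ Mm xM) subrr !mulr0.
(* The wave vanishes beyond p^N, so the exterior of the unit ball may be replaced by a finite
   shell. *)
pose K := Num.max N 0; have NK : N <= K by rewrite le_max lexx.
have K0 : 0 <= K by rewrite le_max lexx orbT.
have outer : cint (outer_part (riesz_weight a) (wave R N b)) = P K - P 0.
  rewrite (_ : outer_part _ _ =
      (fun x => (shell K 0 x)%:R * (riesz_weight a x * wave R N b x))).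
    by have [_ ->] := shell_sum pp hmu hw sw Bw (fun k _ => hP k) K0.
  apply/funext => x; rewrite /outer_part /shell.
  have [xK|xK] := boolP (inball K x); first by [].
  have xN : ~~ inball N x by apply: contra xK; exact: inball_le.
  by rewrite /wave (negPf xN) mul0r !mulr0.
(* The values at radius 1 cancel: (P 0 - A 0) + (P K - P 0) + A 0 = P K. What remains is p^(ma) (T -
   p^(a-n)), and T - p^(a-n) is the Gamma factor. *)
rewrite abs_pow_pairingE inner outer w0 -/T.
have PK : P K = A m - q (m + 1) * (vol m)%:C.
  by rewrite /P leNgt (lt_le_trans mN NK).
have A0 : A 0 = T.
  by rewrite /A /ppow mulr0z mul0r mulr0 cexp0 mulr1.
rewrite A0 PK mul1r (_ : _ + _ + T = A m - q (m + 1) * (vol m)%:C); last by ring.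
rewrite /A /q /T /padic_Gamma !cpow_p !ppowA !ppowD !ppowN -!(ppow_nat R n pp).
have [v1 vm] := (ppow_neq0 p 1 (n%:R : R[i]), ppow_neq0 p m (n%:R : R[i])).
have c1 := ppow_neq0 p 1 a.
by field; rewrite v1 vm c1 subr_eq0 a1.
Qed.

End Generic.

(** * The logarithmic kernel *)

Section LogKernel.
Variables (R : realType) (p n : nat) (mu : {measure set (borel_Qpn p n) -> \bar R}).
Hypothesis pp : prime p.
Hypothesis n0 : (0 < n)%N.
Hypothesis hmu : normalized_haar mu.
Notation V := 'rV[Qp p]_n.
Implicit Types (x y b : V) (k l m K M N : int) (f g phi : V -> R[i]) (c : R[i]).
Notation cint f := (cintegral mu setT f).
Notation vol := (haar_vol R p n).
Let L : R := ln p%:R.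

Lemma vol_small (e : R) : 0 < e -> exists j : nat, vol (- j%:Z) < e.
Proof.
move=> e0; exists (Num.truncn e^-1).+1.
rewrite /haar_vol -exprnN -[ltRHS]invrK ltf_pV2 ?posrE ?invr_gt0 ?exprn_gt0 ?natr_p_gt0 //.
apply: lt_trans (truncnS_gt _) _; rewrite -!natrX ltr_nat.
by apply: ltn_expl; rewrite -(expn0 p) ltn_exp2l // prime_gt1.
Qed.

Lemma vol_lt1 : vol (-1) < 1.
Proof.
rewrite /haar_vol -[-1]/(- 1%:Z) -exprnN expr1 invf_lt1 ?pn_gt0 //.
by rewrite -natrX ltr1n -(expn0 p) ltn_exp2l // prime_gt1.
Qed.

Lemma measurable_zero : measurable ([set 0] : set (borel_Qpn p n)).
Proof.
rewrite (_ : [set 0] = \bigcap_j [set x : V | inball (- j%:Z) (x - 0)]).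
  by apply: bigcapT_measurable => j; exact: measurable_inball.
apply/seteqP; split=> [x /= -> j _ /=|x /= hx]; first by rewrite subr0 inball0.
apply/eqP; apply: contraT => /(Qpn_norm_val pp)[k hk].
by have := hx (`|k|.+1)%N I; rewrite /= subr0 (inball_prad pp _ hk); lia.
Qed.

Lemma mu_zero : mu [set 0] = 0%E.
Proof.
apply/eqP; rewrite eq_le measure_ge0 andbT; apply/lee_addgt0Pr => e e0.
have [j hj] := vol_small e0; rewrite add0e.
apply: (@le_trans _ _ (vol (- j%:Z))%:E); last by rewrite lee_fin ltW.
rewrite -(mu_inball pp hmu _ 0); apply: le_measure.
- by rewrite inE; exact: measurable_zero.
- by rewrite inE; exact: measurable_inball.
- by move=> x /= ->; rewrite subr0 inball0.
Qed.

(** Removing the origin, a null set, lets the layer formula below hold at every point, with ln 0 = 0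
    as the value at the origin. *)
Definition pball k : set V := [set x | inball k (x - 0)] `\` [set 0].

Lemma pballE k x : (x \in pball k) = inball k x && (x != 0).
Proof.
apply/idP/andP => [/set_mem[/=]|[xk x0]]; first by rewrite subr0 => -> /eqP.
by apply/mem_set; split=> /=; [rewrite subr0 | exact/eqP].
Qed.

Lemma measurable_pball k : measurable (pball k : set (borel_Qpn p n)).
Proof. by apply: measurableD; [exact: measurable_inball | exact: measurable_zero]. Qed.

Lemma mu_pball k : mu (pball k) = (vol k)%:E.
Proof.
have e : mu [set x : V | inball k (x - 0)] = (vol k)%:E := mu_inball pp hmu k 0.
transitivity (mu [set x : V | inball k (x - 0)] - mu [set 0%R])%E; last first.
  by rewrite e mu_zero sube0.
transitivity (mu [set x : V | inball k (x - 0)] -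
    mu ([set x : V | inball k (x - 0)] `&` [set 0%R]))%E.
  apply: measureD; [exact: measurable_inball|exact: measurable_zero|].
  suff : (mu [set x : V | inball k (x - 0)%R] < +oo)%E by [].
  by rewrite e ltry.
congr (_ - mu _)%E.
by apply/seteqP; split=> [x []//|x /= ->]; rewrite subr0 inball0.
Qed.

(** This is ln(p^m / |x|) on the punctured ball of radius p^m. It is nonnegative, which the
    logarithm itself is not, so a series of layers may be integrated term by term. *)
Definition log_defect m x : R :=
  if inball m x && (x != 0) then m%:~R * L - ln (Qpn_abs R x) else 0.

(* On the sphere of radius p^i exactly m - i of the punctured balls of radius
   p^(m-1), p^(m-2), ... contain x. *)
Lemma log_defectE m x :
  (log_defect m x)%:E = (\sum_(j <oo) (L * \1_(pball (m - 1 - j%:Z)) x)%:E)%E.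
Proof.
have L0 : 0 < L := ln_p_gt0 R pp.
rewrite /log_defect; case: ifPn => [/andP[xm x0]|h]; last first.
  rewrite eseries0 // => j _ _; rewrite indicE pballE.
  case: (boolP (_ && _)) => [/andP[xj x0]|_]; rewrite ?mulr0 //.
  case/negP: h; rewrite x0 andbT; apply: inball_le xj => //; lia.
have [i hi] := Qpn_norm_val pp x0; rewrite (inball_prad pp _ hi) in xm.
rewrite (@nneseries_split _ _ 0%N `|m - i|%N); last first.
  by move=> k _; rewrite lee_fin mulr_ge0 // ltW.
rewrite eseries0 ?adde0; last first.
  move=> j hj _; rewrite indicE pballE (inball_prad pp _ hi).
  by rewrite (_ : _ <= _ = false) ?mulr0 //; lia.
rewrite (eq_big_nat _ _ (F2 := fun=> L%:E)) => [|j /andP[_ hj]]; last first.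
  rewrite indicE pballE (inball_prad pp _ hi) x0 andbT.
  by rewrite (_ : _ <= _ = true) ?mulr1 //; lia.
rewrite sumEFin big_const_nat add0n subn0 iter_addr addr0 -mulr_natl.
rewrite /Qpn_abs hi ratr_prad ln_exprz ?natr_p_gt0 // -mulrBl -intrB.
by congr (_ * _)%:E; rewrite -[RHS]/((`|m - i|%N%:Z)%:~R); congr intr; lia.
Qed.

(** The layers have integrals L p^(n(m-1-j)), a geometric series of ratio p^(-n) < 1. Its finite sum
    also gives integrability. *)
Lemma integral_log_defect m :
  mu.-integrable setT (EFin \o log_defect m) /\
  (\int[mu]_x (log_defect m x)%:E = (L * vol (m - 1) / (1 - vol (-1)))%:E)%E.
Proof.
have L0 : 0 < L := ln_p_gt0 R pp.
have mf j : measurable_fun setT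
    (fun x : borel_Qpn p n => (L * \1_(pball (m - 1 - j%:Z)) x)%:E).
  apply/measurable_EFinP/measurable_funM; first exact: measurable_cst.
  by apply: measurable_indic; exact: measurable_pball.
have f0 j x : setT x -> (0 <= (L * \1_(pball (m - 1 - j%:Z)) x)%:E)%E.
  by move=> _; rewrite lee_fin mulr_ge0 // ltW.
have ival : (\int[mu]_x (log_defect m x)%:E = (L * vol (m - 1) / (1 - vol (-1)))%:E)%E.
  under eq_integral do rewrite log_defectE.
  rewrite integral_nneseries //.
  rewrite (eq_eseriesr (g := fun j => (geometric (L * vol (m - 1)) (vol (-1)) j)%:E)).
    apply/cvg_lim => //; apply: cvg_EFin.
      by apply: nearW => j; rewrite sumEFin.
    have v1 : `|vol (-1)| < 1 by rewrite gtr0_norm ?vol_gt0 // vol_lt1.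
    have := @cvg_geometric_series R (L * vol (m - 1)) _ v1.
    rewrite (_ : fine \o _ = series (geometric (L * vol (m - 1)) (vol (-1)))) //.
    by apply/funext => j /=; rewrite sumEFin.
  move=> j _; under eq_integral do rewrite EFinM.
  rewrite ge0_integralZl ?lee_fin ?(ltW L0) //; last first.
    by apply/measurable_EFinP; apply: measurable_indic; exact: measurable_pball.
  rewrite integral_indic; [|exact: measurableT|exact: measurable_pball].
  rewrite setIT mu_pball -EFinM /= -mulrA; congr (_ * _)%:E.
  rewrite (volD R n pp (m - 1) (- j%:Z)); congr (_ * _); rewrite /haar_vol -exprnN -[-1]/(- 1%:Z) -exprnN expr1.
  by rewrite exprVn.
split=> //; apply/integrableP; split.
  rewrite (_ : _ \o _ = (fun x => \sum_(j <oo | j \in xpredT)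
      (L * \1_(pball (m - 1 - j%:Z)) x)%:E)%E).
    by apply: ge0_emeasurable_sum => // j x xT _; exact: f0.
  by apply/funext => x; rewrite /= log_defectE.
under eq_integral => x _.
  rewrite gee0_abs; last first.
    by rewrite /= log_defectE; apply: nneseries_ge0 => j _ _; exact: f0.
  over.
by rewrite ival ltry.
Qed.

Definition ball_log m x : R := (inball m x)%:R * ln (Qpn_abs R x).

Lemma ball_logE m x :
  ball_log m x = m%:~R * L * \1_(pball m) x + (-1) * log_defect m x.
Proof.
rewrite /ball_log /log_defect indicE pballE.
have [->|x0] := eqVneq x 0.
  by rewrite /Qpn_abs Qpn_norm0 rmorph0 ln0 // andbF !mulr0 addr0.
by case: (inball m x) => /=; ring.
Qed.

Lemma integral_ball_log m :
  cintegrable mu (fun x => (ball_log m x)%:C) /\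
  cint (fun x => (ball_log m x)%:C) =
    (m%:~R * L * vol m - L * vol (m - 1) / (1 - vol (-1)))%:C.
Proof.
have [idef vdef] := integral_log_defect m.
pose B x : R[i] := (\1_(pball m) x : R)%:C.
pose D x : R[i] := (log_defect m x)%:C.
have iB : cintegrable mu B.
  apply/cintegrable_real/integrable_indic_lt_pinfty; first exact: measurable_pball.
  by rewrite mu_pball ltry.
have vB : cint B = (vol m)%:C.
  rewrite cint_real; congr (_%:C); rewrite /Rintegral integral_indic ?setIT.
  - by rewrite mu_pball.
  - exact: measurableT.
  - exact: measurable_pball.
have iD : cintegrable mu D by exact: cintegrable_real.
have vD : cint D = (L * vol (m - 1) / (1 - vol (-1)))%:C.
  by rewrite cint_real /Rintegral vdef.
have -> : (fun x => (ball_log m x)%:C) =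
    (fun x => (m%:~R * L)%:C * B x + (-1)%:C * D x).
  by apply/funext => x; rewrite ball_logE rmorphD !rmorphM.
split; first by apply: cintegrableD; exact: cintegrableZ.
rewrite cintD; [|exact: cintegrableZ..]; rewrite !cintZ // vB vD.
by rewrite -!rmorphM -rmorphD mulN1r.
Qed.

End LogKernel.

(** * Cut-off characters as eigenfunctions *)

Section RieszPairing.
Variables (R : realType) (p n : nat) (mu : {measure set (borel_Qpn p n) -> \bar R}).
Hypothesis pp : prime p.
Hypothesis n0 : (0 < n)%N.
Hypothesis hmu : normalized_haar mu.
Notation V := 'rV[Qp p]_n.
Notation chi := (Qp_char R).
Implicit Types (x y b : V) (k l m K M N : int) (f g phi : V -> R[i]) (a c alpha : R[i]).
Notation cint f := (cintegral mu setT f).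
Notation vol := (haar_vol R p n).
Notation cp := (@ppow R p).

Definition log_weight : V -> R[i] := fun x =>
  (- (1 - p%:R ^- n) / ln p%:R * ln (Qpn_abs R x))%:C.

Lemma radial_log_weight : radial log_weight.
Proof. by move=> x y xy; rewrite /log_weight /Qpn_abs xy. Qed.

(** All of the singularity goes into a multiple of [ball_log], whose integral is known; the other
    summand vanishes near 0 and is a step function. *)
Lemma log_weight_split m phi : (forall x, inball m x -> phi x = phi 0) ->
  (fun x => log_weight x * phi x) = (fun x =>
    log_weight x * (phi x + (- phi 0) * ind R m 0 x) +
    phi 0 * (- (1 - p%:R ^- n) / ln p%:R)%:C * (ball_log R m x)%:C).
Proof.
move=> hm; apply/funext => x; rewrite /log_weight /ball_log /ind subr0.
have [xm|xm] := boolP (inball m x).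
  have [e1 e2] : true%:R = 1 :> R[i] /\ true%:R = 1 :> R by [].
  rewrite hm // e1 e2 mulr1 subrr mulr0 add0r [1 * ln _]mul1r rmorphM.
  by rewrite mulrC mulrA.
by rewrite mul0r rmorph0 !mulr0 !addr0.
Qed.

Lemma stepf_log_weight m phi : stepf phi -> (forall x, inball m x -> phi x = phi 0) ->
  stepf (fun x => log_weight x * (phi x + (- phi 0) * ind R m 0 x)).
Proof.
move=> sp hm; apply: (@stepf_weight _ _ _ pp _ _ m).
- exact: radial_log_weight.
- by move=> x xm; rewrite /ind subr0 xm hm // mulr1 subrr.
- by apply: stepfD => //; apply: stepfZ => //; exact: stepf_ind.
Qed.

Lemma cintegrable_log_weight phi : stepf phi ->
  cintegrable mu (fun x => log_weight x * phi x).
Proof.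
move=> sp; have [m hm] := stepf_near0 sp; rewrite (log_weight_split hm).
apply: cintegrableD; first exact/(stepf_cintegrable pp hmu)/stepf_log_weight.
by apply: cintegrableZ; have [] := integral_ball_log pp n0 hmu m.
Qed.

Lemma log_pairing_wave N b m : Qpn_norm b = prad p (- m) -> m < N ->
  cint (fun x => log_weight x * wave R N b x) = (vol m)%:C.
Proof.
move=> bm mN; pose L : R := ln p%:R; pose kap : R := - (1 - p%:R ^- n) / L.
have L0 : L != 0 := lt0r_neq0 (ln_p_gt0 R pp).
have bk k : inball (- k) b = (k <= m) by rewrite (inball_prad pp _ bm) lerN2.
have bN : ~~ inball (- N) b by rewrite bk -ltNge.
have near0 x : inball m x -> wave R N b x = 1.
  by move=> xm; apply: (wave_near0 R pp (ltW mN) _ xm); rewrite bk.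
have w0 : wave R N b 0 = 1 by apply: near0; exact: inball0.
pose q k : R[i] := (kap * (k%:~R * L))%:C.
pose B k : R[i] := if k <= m then (vol k)%:C else 0.
(* Outside the ball of radius p^m only the sphere of radius p^(m+1) contributes, where [B] drops
   from p^(nm) to 0. *)
pose P k : R[i] := if k <= m then 0 else - q (m + 1) * (vol m)%:C.
have hw x k : Qpn_norm x = prad p k -> log_weight x = q k.
  by move=> xk; rewrite /log_weight /Qpn_abs xk ratr_prad ln_exprz // natr_p_gt0.
have Bw k : cint (fun x => (inball k x)%:R * wave R N b x) = B k.
  by rewrite cint_ball_wave // bk.
have sw k : stepf (fun x => (inball k x)%:R * wave R N b x).
  exact: (stepf_ballM pp (fun b : bool => b%:R : R[i]) k (stepf_wave R pp N b)).
have hP k : m <= k -> P (k + 1) - P k = q (k + 1) * (B (k + 1) - B k).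
  move=> mk; rewrite /P /B [k + 1 <= m](_ : _ = false); last by lia.
  case: (leP k m) => km; last by rewrite !subrr mulr0.
  have -> : k = m by lia.
  by ring.
have [sI vI] := shell_sum pp hmu hw sw Bw hP (ltW mN).
have [iL vL] := integral_ball_log pp n0 hmu m.
rewrite (_ : (fun x => _) = (fun x =>
    (shell N m x)%:R * (log_weight x * wave R N b x) + kap%:C * (ball_log R m x)%:C)).
  rewrite cintD; [|exact: (stepf_cintegrable pp hmu)|exact: cintegrableZ].
  rewrite cintZ // vI vL /P lexx leNgt mN /= subr0 /q -rmorphN -!rmorphM -rmorphD.
  (* The terms with factor m cancel. The sphere leaves (1 - p^(-n)) p^(nm) and the ball p^(-n)
     p^(nm), with sum p^(nm). *)
  congr (_%:C); rewrite (volD R n pp m (-1)) -/L.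
  have v1 : 1 - vol (-1) != 0 by rewrite subr_eq0 gt_eqF // vol_lt1.
  have -> : kap = - (1 - vol (-1)) / L.
    by rewrite /kap /haar_vol -[-1 in RHS]/(- 1%:Z) -exprnN expr1.
  by rewrite intrD; field; rewrite L0 v1.
apply/funext => x; rewrite /shell /ball_log.
have [xm|xm] := boolP (inball m x).
  rewrite near0 // andbF mul0r add0r mulr1 mul1r -rmorphM; congr (_%:C).
rewrite mul0r mulr0 addr0 andbT.
have [xN|xN] := boolP (inball N x); first by rewrite mul1r.
by rewrite /wave (negPf xN) !mul0r mulr0.
Qed.

Lemma riesz_pairingL a c f g : stepf f -> stepf g ->
  riesz_pairing mu a (fun x => c * f x + g x) =
  c * riesz_pairing mu a f + riesz_pairing mu a g.
Proof.
move=> sf sg; rewrite /riesz_pairing; case: asboolP => // _.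
case: asboolP => _; last by rewrite abs_pow_pairingL // mulrDl mulrA.
have iF := cintegrable_log_weight sf; have iG := cintegrable_log_weight sg.
rewrite -/(log_weight) -(cintZ _ iF) -cintD //; last exact: cintegrableZ.
by apply: (congr1 (fun h : V -> R[i] => cint h)); apply/funext => x; rewrite /log_weight; ring.
Qed.

(** The three cases of the kernel agree in p^(ma): it is 1 at mu_j, the value of the wave at 0; it
    is the volume p^(mn) at n + mu_j; elsewhere the nonzero Gamma factor cancels. *)
Lemma riesz_pairing_wave a N b m : Qpn_norm b = prad p (- m) -> m < N ->
  riesz_pairing mu a (wave R N b) = cp m a.
Proof.
move=> bm mN; rewrite /riesz_pairing.
have w0 : wave R N b 0 = 1 by rewrite /wave inball0 // Qchar0 // mul1r.
case: asboolP => [[j ->]|a1]; first by rewrite w0 ppow_pole.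
case: asboolP => [[j ->]|an].
  by rewrite ppowA ppow_pole // mulr1 (ppow_nat R n pp); exact: log_pairing_wave.
have c1 : cp 1 a != 1 by apply/eqP => /(ppow_eq1 pp).
have cn : cp 1 (a - n%:R) != 1.
  apply/eqP => /(ppow_eq1 pp)[j hj]; apply: an; exists j.
  by rewrite -hj addrC subrK.
rewrite (abs_pow_pairing_wave pp hmu c1 bm mN) mulrAC divff ?mul1r //.
rewrite /padic_Gamma !cpow_p mulf_neq0 ?invr_eq0 ?subr_eq0 1?eq_sym //.
by rewrite ppowN invr_eq1.
Qed.

Lemma riesz_pairing_far a N b x : ~~ inball N x -> ~~ inball (- N) b ->
  riesz_pairing mu a (fun y => wave R N b (x - y)) = 0.
Proof.
move=> xN bN; set phi := fun y => _.
have wN y : ~~ inball N y -> wave R N b y = 0 by move=> h; rewrite /wave (negPf h) mul0r.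
have phi0 : phi 0 = 0 by rewrite /phi subr0 wN.
have sphi : stepf phi.
  rewrite (_ : phi = (fun y => wave R N b (- (y + - x)))).
    apply: (@stepf_translate _ _ _ pp (fun z => wave R N b (- z)) (- x)).
    exact: stepf_opp (stepf_wave R pp N b).
  by apply/funext => y; rewrite /phi opprD opprK addrC.
have iphi := stepf_cintegrable pp hmu sphi.
have Iphi : cint phi = 0.
  rewrite (_ : phi = (fun y => (fun z => wave R N b (- z)) (y + - x))).
    transitivity (cint (fun z : V => wave R N b (- z))).
      apply: (@cint_translate _ _ _ _ pp hmu (fun z => wave R N b (- z)) (- x)).
      exact: stepf_opp (stepf_wave R pp N b).
    rewrite (_ : (fun z => _) = wave R N (- b)).
      by rewrite cint_wave // inballN (negPf bN).
    by apply/funext => z; rewrite /wave inballN QcharNl.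
  by apply/funext => y; rewrite /phi opprD opprK addrC.
(* The indicator of the unit ball and of its complement depend on the norm alone, like the weight,
   so all are constant on the ball of radius p^N about x. The factor [F] covers both domains of
   integration. *)
have zero (w : V -> R[i]) (F : bool -> R[i]) : radial w ->
    cint (fun y => F (inball 0 y) * (w y * phi y)) = 0.
  move=> hw; rewrite (_ : (fun y => _) = (fun y => F (inball 0 x) * w x * phi y)).
    by rewrite cintZ // Iphi mulr0.
  apply/funext => y; rewrite /phi; have [xy|xy] := boolP (inball N (x - y)); last first.
    by rewrite wN // !mulr0.
  have nxy := norm_far pp xN xy.
  have -> : inball 0 y = inball 0 x.
    Transparent inball.
    by rewrite /inball nxy.
  by rewrite (hw y x) // mulrA.
rewrite /riesz_pairing phi0; case: asboolP => // _; case: asboolP => _.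
  rewrite -[RHS](zero log_weight (fun=> 1)); last exact: radial_log_weight.
  by apply: (congr1 (fun h : V -> R[i] => cint h)); apply/funext => y; rewrite mul1r.
rewrite abs_pow_pairingE phi0 mul0r addr0.
rewrite (_ : inner_part _ _ = (fun y => (inball 0 y)%:R * (riesz_weight a y * phi y))).
  rewrite (zero _ (fun u : bool => u%:R)); last exact: radial_riesz_weight.
  rewrite /outer_part (zero _ (fun u : bool => (~~ u)%:R)); last exact: radial_riesz_weight.
  by rewrite addr0 mul0r.
by apply/funext => y; rewrite /inner_part phi0 subr0.
Qed.
Opaque inball.

Lemma taibleson_wave alpha N b m : Qpn_norm b = prad p (- m) -> m < N ->
  taibleson mu alpha (wave R N b) = (fun x => cp (- m) alpha * wave R N b x).
Proof.
move=> bm mN; apply/funext => x; rewrite /taibleson.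
have bN : ~~ inball (- N) b by rewrite (inball_prad pp _ bm) lerN2 -ltNge.
have [xN|xN] := boolP (inball N x); last first.
  by rewrite riesz_pairing_far // /wave (negPf xN) mul0r mulr0.
(* Linearity is available for c f + g; the zero function in place of g extracts homogeneity. *)
pose Z : V -> R[i] := fun=> 0.
have sZ : stepf Z by exists 0, 0.
have r0 : riesz_pairing mu (- alpha) Z = 0.
  have := riesz_pairingL (- alpha) 1 sZ sZ.
  rewrite (_ : (fun _ => _) = Z); last by apply/funext => y; rewrite /Z mulr0 addr0.
  by rewrite mul1r -[X in X = _]addr0 => /addrI.
(* For x inside the ball, x - y and y are cut off together and the character splits, so the wave of
   frequency -b is paired with the kernel of order -alpha; p^(-m alpha) is |b|^alpha. *)
rewrite (_ : (fun y => _) = (fun y => wave R N b x * wave R N (- b) y + Z y)).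
  rewrite riesz_pairingL //; last exact: stepf_wave.
  rewrite r0 addr0 (@riesz_pairing_wave _ _ _ m) ?Qpn_normN //.
  by rewrite mulrC ppowNl.
have e y : inball N (x - y) = inball N y by rewrite addrC inballDr // inballN.
apply/funext => y; rewrite /Z addr0 /wave xN mul1r e (QcharD R pp b x (- y)) QcharNl.
exact: mulrCA.
Qed.

End RieszPairing.

(** * The Lizorkin space *)

Section LizorkinSpace.
Variables (R : realType) (p n : nat) (mu : {measure set (borel_Qpn p n) -> \bar R}).
Hypothesis pp : prime p.
Hypothesis n0 : (0 < n)%N.
Hypothesis hmu : normalized_haar mu.
Notation V := 'rV[Qp p]_n.
Notation chi := (Qp_char R).
Implicit Types (x y b : V) (k l m K M N : int) (f g phi psi : V -> R[i]).
Implicit Types (c alpha : R[i]) (s : seq (V * R[i])) (t : Qp p).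
Notation cint f := (cintegral mu setT f).
Notation vol := (haar_vol R p n).
Notation cp := (@ppow R p).

(** Centring the ball at 0 brings out chi(b.x), and the transform of a centred ball is its volume on
    the dual ball. *)
Lemma fourier_ind k b :
  fourier mu (ind R k b) = (fun x => (vol k)%:C * wave R (- k) b x).
Proof.
apply/funext => x; rewrite /fourier.
have -> : (fun y => chi x y * ind R k b y) =
    (fun y => (fun z => chi x b * wave R k x z) (y + - b)).
  apply/funext => y; rewrite /ind /wave -{1}[y](subrK b) (QcharD R pp x (y - b) b).
  by move: (chi x (y - b)) (chi x b) (inball k (y - b)) => u v w; ring.
transitivity (cint (fun z : V => chi x b * wave R k x z)).
  apply: (@cint_translate _ _ _ _ pp hmu (fun z => chi x b * wave R k x z) (- b)).
  exact/(stepfZ pp)/stepf_wave.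
rewrite cintZ; last exact/(stepf_cintegrable pp hmu)/stepf_wave.
rewrite cint_wave // /wave (QcharC R b x).
by case: (inball (- k) x); [rewrite mul1r mulrC|rewrite mul0r !mulr0].
Qed.

Lemma fourier_sum (I : Type) (r : seq I) (F : I -> V -> R[i]) (a : I -> R[i]) :
  (forall i, stepf (F i)) ->
  fourier mu (fun x => \sum_(i <- r) a i * F i x) =
  (fun x => \sum_(i <- r) a i * fourier mu (F i) x).
Proof.
move=> sF; apply/funext => x; rewrite /fourier.
have iF i : cintegrable mu (fun y => chi x y * F i y).
  apply: (stepf_cintegrable pp hmu); apply: stepf_mull (sF i); first exact: pp.
  exact: loc_cst_char.
rewrite (_ : (fun y => _) = (fun y => \sum_(i <- r) a i * (chi x y * F i y))).
  rewrite cint_sum => [|i]; last exact: cintegrableZ.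
  by apply: eq_bigr => i _; rewrite cintZ.
by apply/funext => y; rewrite mulr_sumr; apply: eq_bigr => i _; rewrite mulrCA.
Qed.

Lemma stepf_sum (I : Type) (r : seq I) (F : I -> V -> R[i]) (a : I -> R[i]) :
  (forall i, stepf (F i)) -> stepf (fun x => \sum_(i <- r) a i * F i x).
Proof.
move=> sF; elim: r => [|i r ih].
  by exists 0, 0; split=> *; rewrite !big_nil.
rewrite (_ : (fun x => _) = (fun x => a i * F i x + \sum_(i <- r) a i * F i x)).
  exact: stepfL.
by apply/funext => x; rewrite big_cons.
Qed.

(** The list holds pairs of a frequency and a coefficient, so operators on Phi become maps on lists;
    frequencies may repeat. *)
Definition waves N s : V -> R[i] := fun x => \sum_(q <- s) q.2 * wave R N q.1 x.

Definition high_freq N s := all (fun q => ~~ inball (- N) q.1) s.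

Lemma stepf_waves N s : stepf (waves N s).
Proof. by apply: stepf_sum => q; exact: stepf_wave. Qed.

Lemma lizorkin_phiP phi :
  lizorkin_phi mu phi <-> exists N s, high_freq N s /\ phi = waves N s.
Proof.
split=> [[psi [tpsi psi0] <-]|[N [s [hs ->]]]].
  have [k [j hst]] := stepfP pp (test_fun_step pp tpsi).
  set l := k - j%:Z in hst *.
  pose T := 'rV['I_(p ^ j)]_n.
  exists (- l), [seq (coset_rep k d, psi (coset_rep k d) * (vol l)%:C) |
    d <- enum {: T} & ~~ inball l (coset_rep k d)]; split.
    by apply/allP => q /mapP[c]; rewrite mem_filter => /andP[hc _] -> /=; rewrite opprK.
  rewrite {1}(step_fun_decomp pp hst) fourier_sum => [|c]; last exact: stepf_ind.
  apply/funext => x; rewrite /waves big_map big_filter big_enum_cond /=.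
  rewrite [LHS](bigID (fun d => ~~ inball l (coset_rep k d))) /=.
  (* The coset containing 0 drops out because psi equals psi(0) = 0 on it; the other representatives
     have norm above p^l, as required with N = -l. *)
  rewrite [X in _ + X]big1 ?addr0 => [|c]; last first.
    rewrite negbK => hc; rewrite (_ : psi _ = 0) ?mul0r // -psi0.
    by apply: hst.2; rewrite subr0.
  by apply: eq_bigr => c _; rewrite fourier_ind mulrA.
(* Division by the volume of the balls compensates the factor that the Fourier transform produces.
   None of these balls contains 0, hence psi(0) = 0. *)
pose psi x := \sum_(q <- s) (q.2 / (vol (- N))%:C) * ind R (- N) q.1 x.
have spsi : stepf psi by apply: stepf_sum => q; exact: stepf_ind.
exists psi; first split.
- by have [k [l h]] := spsi; exact: step_fun_test h.
- rewrite /psi big_seq big1 // => q qs; move/allP/(_ q qs): hs.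
  by rewrite /ind sub0r inballN => /negPf ->; rewrite mulr0.
rewrite fourier_sum => [|q]; last exact: stepf_ind.
apply/funext => x; apply: eq_bigr => q _; rewrite fourier_ind opprK mulrA divfK //.
by rewrite -(ppow_nat R n pp) ppow_neq0.
Qed.

Lemma stepf_reflect f x : stepf f -> stepf (fun y => f (x - y)).
Proof.
move=> sf; rewrite (_ : (fun y => _) = (fun y => f (- (y + - x)))).
  apply: (@stepf_translate _ _ _ pp (fun z => f (- z)) (- x)).
  exact: stepf_opp.
by apply/funext => y; rewrite opprD opprK addrC.
Qed.

Lemma taiblesonL alpha c f g : stepf f -> stepf g ->
  taibleson mu alpha (fun x => c * f x + g x) =
  (fun x => c * taibleson mu alpha f x + taibleson mu alpha g x).
Proof.
move=> sf sg; apply/funext => x; rewrite /taibleson.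
by apply: riesz_pairingL => //; exact: stepf_reflect.
Qed.

Lemma taibleson0 alpha : taibleson mu alpha (fun=> 0) = (fun=> 0).
Proof.
have s0 : stepf (fun _ : V => 0 : R[i]) by exists 0, 0.
apply/funext => x; have := congr1 (fun h : V -> R[i] => h x) (taiblesonL alpha 1 s0 s0).
rewrite (_ : (fun _ => _) = (fun=> 0)); last by apply/funext => y; rewrite mulr0 addr0.
by rewrite /= mul1r -[X in X = _]addr0 => /addrI.
Qed.

(** D^alpha as a Fourier multiplier: each coefficient is scaled by |b|^alpha. *)
Definition symbol alpha s := [seq (q.1, cpow (Qpn_abs R q.1) alpha * q.2) | q <- s].

Lemma high_freq_symbol alpha N s : high_freq N (symbol alpha s) = high_freq N s.
Proof. by rewrite /high_freq all_map. Qed.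

Lemma high_freq_norm N b : ~~ inball (- N) b ->
  exists2 m, Qpn_norm b = prad p (- m) & m < N.
Proof.
move=> bN; have b0 : b != 0 by apply: contraNneq bN => ->; exact: inball0.
have [k hk] := Qpn_norm_val pp b0; exists (- k); first by rewrite opprK.
by move: bN; rewrite (inball_prad pp _ hk); lia.
Qed.

Lemma taibleson_waves alpha N s : high_freq N s ->
  taibleson mu alpha (waves N s) = waves N (symbol alpha s).
Proof.
elim: s => [_|[b c] s ih /= /andP[bN hs]].
  have W0 : waves N [::] = (fun=> 0) by apply/funext => x; rewrite /waves big_nil.
  by rewrite /= W0 taibleson0.
rewrite (_ : waves N _ = (fun x => c * wave R N b x + waves N s x)); last first.
  by apply/funext => x; rewrite /waves big_cons.
rewrite taiblesonL; [|exact: stepf_wave|exact: stepf_waves].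
have [m bm mN] := high_freq_norm bN.
rewrite (taibleson_wave pp n0 hmu alpha bm mN) ih //.
apply/funext => x; rewrite /waves big_cons /= (cpow_norm pp _ bm).
by rewrite mulrCA mulrA.
Qed.

Lemma taibleson_phi alpha phi :
  lizorkin_phi mu phi -> lizorkin_phi mu (taibleson mu alpha phi).
Proof.
move=> /lizorkin_phiP[N [s [hs ->]]]; apply/lizorkin_phiP.
by exists N, (symbol alpha s); rewrite high_freq_symbol taibleson_waves.
Qed.

(** The multiplier |b|^(-alpha) gives a preimage, as high frequencies are nonzero. *)
Lemma taibleson_onto alpha phi : lizorkin_phi mu phi ->
  exists2 psi, lizorkin_phi mu psi & taibleson mu alpha psi = phi.
Proof.
move=> /lizorkin_phiP[N [s [hs ->]]]; exists (waves N (symbol (- alpha) s)).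
  by apply/lizorkin_phiP; exists N, (symbol (- alpha) s); rewrite high_freq_symbol.
rewrite taibleson_waves ?high_freq_symbol //; congr (waves N _).
rewrite /symbol -map_comp -[RHS]map_id; apply/eq_in_map => -[b c] bs /=.
move/allP/(_ _ bs)/high_freq_norm: hs => [m bm _] /=.
by rewrite !(cpow_norm pp _ bm) mulrA -ppowA subrr ppow0 mul1r.
Qed.

(** Dividing x by t divides the frequency by t and multiplies the cut-off radius by |t| = p^v, so
    the bound |b| > p^(-N) is carried to the exponent N + v. *)
Definition dilate_freq t s := [seq (t^-1 *: q.1, q.2) | q <- s].

Lemma waves_dilate t v N s : Qp_norm t = prad p v ->
  (fun x => waves N s (t^-1 *: x)) = waves (N + v) (dilate_freq t s).
Proof.
move=> tv; have tv' : Qp_norm t^-1 = prad p (- v) by rewrite Qp_normV tv pradN.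
apply/funext => x; rewrite /waves big_map; apply: eq_bigr => -[b c] _ /=.
rewrite /wave QcharZ; congr (_ * (_%:R * _)).
by rewrite -[N in LHS](addrK v) inballZ.
Qed.

Lemma high_freq_dilate t v N s : Qp_norm t = prad p v ->
  high_freq N s -> high_freq (N + v) (dilate_freq t s).
Proof.
move=> tv; have tv' : Qp_norm t^-1 = prad p (- v) by rewrite Qp_normV tv pradN.
rewrite /high_freq all_map; apply: sub_all => -[b c] /=.
by rewrite opprD inballZ.
Qed.

Lemma lizorkin_phi_dilate t phi : t != 0 -> lizorkin_phi mu phi ->
  lizorkin_phi mu (fun x => phi (t^-1 *: x)).
Proof.
move=> /(Qp_norm_val pp)[v tv] /lizorkin_phiP[N [s [hs ->]]].
rewrite (waves_dilate _ _ tv); apply/lizorkin_phiP.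
by exists (N + v), (dilate_freq t s); split=> //; exact: high_freq_dilate.
Qed.

Lemma taibleson_dilate alpha t phi : t != 0 -> lizorkin_phi mu phi ->
  taibleson mu alpha (fun x => phi (t^-1 *: x)) =
  (fun x => cpow (Qp_abs R t) (- alpha) * taibleson mu alpha phi (t^-1 *: x)).
Proof.
move=> /(Qp_norm_val pp)[v tv] /lizorkin_phiP[N [s [hs ->]]].
rewrite (waves_dilate _ _ tv) (taibleson_waves _ (high_freq_dilate tv hs)).
rewrite taibleson_waves //; have := waves_dilate N (symbol alpha s) tv.
move=> /(congr1 (fun h : V -> R[i] => fun x => cpow (Qp_abs R t) (- alpha) * h x)) /= ->.
apply/funext => x; rewrite /waves !big_map mulr_sumr [LHS]big_seq [RHS]big_seq.
apply: eq_bigr => -[b c] bs /=; move/allP/(_ _ bs)/high_freq_norm: hs => [m bm _].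
have {}bm : Qpn_norm b = prad p (- m) := bm.
have tb : Qpn_norm (t^-1 *: b) = prad p (- v - m).
  by rewrite Qpn_normZ // Qp_normV tv bm -/(prad p v) -pradN -pradD.
rewrite (cpow_norm pp _ tb) (cpow_norm pp _ bm) /Qp_abs tv cpow_prad //.
by rewrite ppowD ppowNl !mulrA.
Qed.

End LizorkinSpace.

(** * Transport of the asymptotics *)

Lemma lizorkin_dualZ (R : realType) (p n : nat)
    (mu : {measure set (borel_Qpn p n) -> \bar R}) (f : ('rV[Qp p]_n -> R[i]) -> R[i])
    (c : R[i]) (phi : 'rV[Qp p]_n -> R[i]) :
  lizorkin_dual mu f -> lizorkin_phi mu (fun=> 0) -> lizorkin_phi mu phi ->
  f (fun x => c * phi x) = c * f phi.
Proof.
move=> hf phi0 hphi; have := hf 1 _ _ phi0 phi0.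
have -> : (fun _ : 'rV[Qp p]_n => 1 * 0 + 0) = (fun=> 0 : R[i]).
  by apply/funext => x; rewrite mulr0 addr0.
rewrite mul1r -[X in X = _]addr0 => /addrI f0.
have := hf c _ _ hphi phi0; rewrite -f0 addr0 => <-.
by congr f; apply/funext => x; rewrite addr0.
Qed.

Lemma cvg_near_eq (T : Type) (U : nbhsType) (F : set_system T) (FF : Filter F)
    (f g : T -> U) (l : U) :
  (\forall t \near F, f t = g t) -> f @ F --> l -> g @ F --> l.
Proof.
move=> fg fl A /fl /= hA; have {}hA : F (f @^-1` A) := hA.
by apply: filterS2 fg hA => t e At; rewrite /preimage /= -e.
Qed.

Theorem theorem7p3 (R : realType) (p n : nat)
    (mu : {measure set (borel_Qpn p n) -> \bar R})
    (f g : ('rV[Qp p]_n -> R[i]) -> R[i]) (rho : Qp p -> R[i]) (beta : R[i]) :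
  prime p -> (1 <= n)%N -> normalized_haar mu ->
  lizorkin_dual mu f -> lizorkin_dual mu g -> automodel rho ->
  quasi_asymp mu f g rho <->
  quasi_asymp mu (taibleson_dual mu beta f) (taibleson_dual mu beta g)
    (fun t => cpow (Qp_abs R t) (- beta) * rho t).
Proof.
move=> pp n1 hmu hf hg _.
have phi0 : lizorkin_phi mu (fun=> 0).
  apply/(lizorkin_phiP pp hmu); exists 0, [::]; split=> //.
  by apply/funext => x; rewrite /waves big_nil.
(* Commuting D^beta with the dilation produces the factor |t|^(-beta) in the numerator, which is
   nonzero and cancels the one in the new scale. *)
have key phi : lizorkin_phi mu phi -> \forall t \near Qp_infty p,
    dilate t f (taibleson mu beta phi) / rho t =
    dilate t (taibleson_dual mu beta f) phi / (cpow (Qp_abs R t) (- beta) * rho t).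
  (* The threshold 0 already ensures t != 0. *)
  move=> hphi; exists 0 => // t /= t0; have {}t0 : t != 0.
    by apply: contraTneq t0 => ->; rewrite Qp_norm0 ltxx.
  rewrite /dilate /taibleson_dual (taibleson_dilate pp n1 hmu _ t0 hphi).
  rewrite (lizorkin_dualZ _ hf phi0); last first.
    exact/(lizorkin_phi_dilate pp hmu t0)/(taibleson_phi pp n1 hmu).
  set c := cpow _ _; have c0 : c != 0 by exact: cexp_neq0.
  by rewrite [_ * (c * _)]mulrCA invfM mulrACA divff // mul1r.
split=> [[[phi hphi gphi] cv]|[[phi hphi gphi] cv]]; split.
(* Surjectivity of D^beta keeps the limit nonzero: a test function that detects g is D^beta psi, and
   psi then detects D^beta g. *)
- have [psi hpsi e] := taibleson_onto pp n1 hmu beta hphi.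
  by exists psi => //; rewrite /taibleson_dual e.
- move=> psi hpsi; apply: (cvg_near_eq _ (key _ hpsi)).
  exact/cv/taibleson_phi.
- by exists (taibleson mu beta phi) => //; exact: taibleson_phi.
(* In this direction surjectivity also gives the convergence, since every test function is some
   D^beta psi'. *)
move=> psi hpsi; have [psi' hpsi' e] := taibleson_onto pp n1 hmu beta hpsi.
rewrite -e; apply: cvg_near_eq (cv _ hpsi').
by apply: filterS (key _ hpsi') => t ->.
Qed.
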